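(* Let $\alpha\in(0,1]$, $\sigma\in(0,1)$, let $k\ge1$ be an integer such that $e_{k-1}(q^{\alpha})\neq0$ for all $q\in\mathbb E$, and let $\mathbf i,\mathbf j\in\mathbb S^2$. If $f\in\mathcal{SR}(\mathbb B)$ and (the restriction of) $f$ belongs to $\mathfrak D^{\sigma}_{\alpha,k,\mathbf i}$, then $$\|f\|^2_{\mathfrak D^{\sigma}_{\alpha,k,\mathbf j}}\le 8\,\|f\|^2_{\mathfrak D^{\sigma}_{\alpha,k,\mathbf i}}.$$
   Context: $\mathbb H$ is the skew field of quaternions, $\mathbb S^2$ the sphere of purely imaginary unit quaternions, $\mathbb C(\mathbf i)=\{x+\mathbf iy: x,y\in\mathbb R\}$ for $\mathbf i\in\mathbb S^2$, $\mathbb B=\{q\in\mathbb H:|q|<1\}$, $\mathbb E=\mathbb B\setminus(-1,0]$ where $(-1,0]$ is the set of real quaternions $q_0$ with $-1<q_0\le0$, and $\Omega_{\mathbf i}=\Omega\cap\mathbb C(\mathbf i)$ for $\Omega\in\{\mathbb B,\mathbb E\}$. A real differentiable function $f:\Omega\to\mathbb H$ is slice regular if $\left(\frac{\partial}{\partial x}+\mathbf i\frac{\partial}{\partial y}\right)f|_{\Omega_{\mathbf i}}=0$ on $\Omega_{\mathbf i}$ for every $\mathbf i\in\mathbb S^2$; $\mathcal{SR}(\Omega)$ is the right $\mathbb H$-module of such functions. For $q\in\mathbb E$, $q^{\alpha}$ is the principal power computed in a complex plane $\mathbb C(I)$, $I\in\mathbb S^2$, containing $q$, and $e_k(q)=\sum_{n=0}^k\frac{q^n}{n!}$.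 For $\mathbf i\in\mathbb S^2$, $f\in\mathcal{SR}(\mathbb E)$ and $z\in\mathbb E_{\mathbf i}$, $$\frac{d^{\sigma}}{dq_{\alpha,k,\mathbf i}}f|_{\mathbb E_{\mathbf i}}(z)=(1-\sigma)f(z)+\sigma\lim_{\zeta\to z,\ \zeta\in\mathbb E_{\mathbf i}}\left(e_k(z^{\alpha})-e_k(\zeta^{\alpha})\right)^{-1}\left(f(z)-f(\zeta)\right),$$ $$\|f\|^2_{\mathfrak D^{\sigma}_{\alpha,k,\mathbf i}}:=\alpha\left|f\left(\tfrac12\right)\right|^2+\int_{\mathbb E_{\mathbf i}}\left|\frac{d^{\sigma}}{dq_{\alpha,k,\mathbf i}}f|_{\mathbb E_{\mathbf i}}(z)\right|^2d_z\mu,$$ where $\mu$ is Lebesgue area measure on $\mathbb C(\mathbf i)$ and $|\cdot|$ is the quaternionic modulus. $\mathfrak D^{\sigma}_{\alpha,k,\mathbf i}$ is the set of all $f\in\mathcal{SR}(\mathbb E)$ with $\|f\|_{\mathfrak D^{\sigma}_{\alpha,k,\mathbf i}}<\infty$. *)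

(* Defs.v *)
From HB Require Import structures.
From mathcomp Require Import all_boot all_order all_algebra.
From mathcomp Require Import ring lra.
From mathcomp Require Import all_classical all_reals all_analysis.
Set Implicit Arguments.
Unset Strict Implicit.
Unset Printing Implicit Defensive.
Import Order.TTheory GRing.Theory Num.Theory.
Import numFieldNormedType.Exports.
Local Open Scope classical_set_scope.
Local Open Scope ring_scope.

(* Quat a b c d is a + b i + c j + d k.  The type carries the structures of a
   unitary R-algebra with inverses and of a normed R-module whose norm is the
   quaternionic modulus, so that [`|q|], [q^-1], [q ^+ n], limits and
   [differentiable] below are the library's. *)
Record quat (R : realType) := Quat { q0 : R ; q1 : R ; q2 : R ; q3 : R }.

Section quaternions.
Variable R : realType.
Local Notation H := (quat R).

Definition quat_tuple (q : H) : R * R * R * R := (q0 q, q1 q, q2 q, q3 q).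
Definition tuple_quat (t : R * R * R * R) : H :=
  let: (a, b, c, d) := t in Quat a b c d.

Lemma quat_tupleK : cancel quat_tuple tuple_quat.
Proof. by case. Qed.

HB.instance Definition _ := Choice.copy H (can_type quat_tupleK).

Lemma quatP (p q : H) : q0 p = q0 q -> q1 p = q1 q -> q2 p = q2 q ->
  q3 p = q3 q -> p = q.
Proof. by case: p q => ? ? ? ? [? ? ? ?] /= -> -> -> ->. Qed.

Definition quat_add (p q : H) : H :=
  Quat (q0 p + q0 q) (q1 p + q1 q) (q2 p + q2 q) (q3 p + q3 q).
Definition quat_opp (q : H) : H := Quat (- q0 q) (- q1 q) (- q2 q) (- q3 q).
Definition quat_scale (r : R) (q : H) : H :=
  Quat (r * q0 q) (r * q1 q) (r * q2 q) (r * q3 q).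
Definition quat_mul (p q : H) : H := Quat
  (q0 p * q0 q - q1 p * q1 q - q2 p * q2 q - q3 p * q3 q)
  (q0 p * q1 q + q1 p * q0 q + q2 p * q3 q - q3 p * q2 q)
  (q0 p * q2 q - q1 p * q3 q + q2 p * q0 q + q3 p * q1 q)
  (q0 p * q3 q + q1 p * q2 q - q2 p * q1 q + q3 p * q0 q).

Fact quat_addA : associative quat_add.
Proof. by move=> x y z; apply: quatP => /=; ring. Qed.
Fact quat_addC : commutative quat_add.
Proof. by move=> x y; apply: quatP => /=; ring. Qed.
Fact quat_add0 : left_id (Quat 0 0 0 0) quat_add.
Proof. by move=> x; apply: quatP => /=; ring. Qed.
Fact quat_addN : left_inverse (Quat 0 0 0 0) quat_opp quat_add.
Proof. by move=> x; apply: quatP => /=; ring. Qed.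

HB.instance Definition _ :=
  GRing.isZmodule.Build H quat_addA quat_addC quat_add0 quat_addN.

Fact quat_mulA : associative quat_mul.
Proof. by move=> x y z; apply: quatP => /=; ring. Qed.
Fact quat_mul1 : left_id (Quat 1 0 0 0) quat_mul.
Proof. by move=> x; apply: quatP => /=; ring. Qed.
Fact quat_mulr1 : right_id (Quat 1 0 0 0) quat_mul.
Proof. by move=> x; apply: quatP => /=; ring. Qed.
Fact quat_mulDl : left_distributive quat_mul +%R.
Proof. by move=> x y z; apply: quatP => /=; ring. Qed.
Fact quat_mulDr : right_distributive quat_mul +%R.
Proof. by move=> x y z; apply: quatP => /=; ring. Qed.
Fact quat_1neq0 : Quat 1 0 0 0 != 0 :> H.
Proof. by apply/eqP => -[] /eqP; rewrite oner_eq0. Qed.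

HB.instance Definition _ := GRing.Zmodule_isNzRing.Build H
  quat_mulA quat_mul1 quat_mulr1 quat_mulDl quat_mulDr quat_1neq0.

Fact quat_scaleA a b (v : H) :
  quat_scale a (quat_scale b v) = quat_scale (a * b) v.
Proof. by apply: quatP => /=; ring. Qed.
Fact quat_scale1 : left_id 1 quat_scale.
Proof. by move=> x; apply: quatP => /=; ring. Qed.
Fact quat_scaleDr : right_distributive quat_scale +%R.
Proof. by move=> x y z; apply: quatP => /=; ring. Qed.
Fact quat_scaleDl v : {morph quat_scale^~ v : a b / a + b}.
Proof. by move=> x y; apply: quatP => /=; ring. Qed.

HB.instance Definition _ := GRing.Zmodule_isLmodule.Build R H
  quat_scaleA quat_scale1 quat_scaleDr quat_scaleDl.

Fact quat_scaleAl (a : R) (u v : H) : a *: (u * v) = (a *: u) * v.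
Proof. by apply: quatP => /=; ring. Qed.
HB.instance Definition _ := GRing.Lmodule_isLalgebra.Build R H quat_scaleAl.

Fact quat_scaleAr (a : R) (u v : H) : a *: (u * v) = u * (a *: v).
Proof. by apply: quatP => /=; ring. Qed.
HB.instance Definition _ := GRing.Lalgebra_isAlgebra.Build R H quat_scaleAr.

Definition quat_sqnorm (q : H) : R :=
  q0 q ^+ 2 + q1 q ^+ 2 + q2 q ^+ 2 + q3 q ^+ 2.

Lemma quat_sqnorm_ge0 q : 0 <= quat_sqnorm q.
Proof. by rewrite /quat_sqnorm !addr_ge0 ?sqr_ge0. Qed.

Lemma quat_sqnorm_eq0 q : (quat_sqnorm q == 0) = (q == 0).
Proof.
apply/eqP/eqP => [|->]; last by rewrite /quat_sqnorm /= expr0n /= !addr0.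
case: q => a b c d; rewrite /quat_sqnorm /= => h.
have ha := sqr_ge0 a; have hb := sqr_ge0 b.
have hc := sqr_ge0 c; have hd := sqr_ge0 d.
by apply: quatP => /=; apply/eqP; rewrite -sqrf_eq0; apply/eqP; lra.
Qed.

Definition quat_inv (q : H) : H := (quat_sqnorm q)^-1 *:
  Quat (q0 q) (- q1 q) (- q2 q) (- q3 q).

Fact quat_mulVr : {in [pred q | q != 0], left_inverse 1 quat_inv *%R}.
Proof.
move=> q; rewrite inE -quat_sqnorm_eq0 => h.
by apply: quatP => /=; move: h; rewrite /quat_sqnorm => h; field.
Qed.
Fact quat_divrr : {in [pred q | q != 0], right_inverse 1 quat_inv *%R}.
Proof.
move=> q; rewrite inE -quat_sqnorm_eq0 => h.
by apply: quatP => /=; move: h; rewrite /quat_sqnorm => h; field.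
Qed.
Fact quat_unitP (x y : H) : y * x = 1 /\ x * y = 1 -> [pred q | q != 0] x.
Proof.
move=> [h _]; apply/eqP => x0; move: h; rewrite x0 mulr0 => /esym/eqP.
by rewrite oner_eq0.
Qed.
Fact quat_inv_out : {in [predC [pred q : H | q != 0]], quat_inv =1 id}.
Proof.
by move=> q; rewrite !inE negbK => /eqP ->; apply: quatP => /=; ring.
Qed.

HB.instance Definition _ := GRing.NzRing_hasMulInverse.Build H
  quat_mulVr quat_divrr quat_unitP quat_inv_out.

Definition quat_norm (q : H) : R := Num.sqrt (quat_sqnorm q).

Fact quat_normD x y : quat_norm (x + y) <= quat_norm x + quat_norm y.
Proof.
have hx := quat_sqnorm_ge0 x; have hy := quat_sqnorm_ge0 y.
rewrite -(@ler_pXn2r _ 2) ?nnegrE ?addr_ge0 ?sqrtr_ge0//.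
rewrite sqrrD !sqr_sqrtr ?quat_sqnorm_ge0//.
rewrite /quat_norm -sqrtrM//.
set dot := q0 x * q0 y + q1 x * q1 y + q2 x * q2 y + q3 x * q3 y.
have -> : quat_sqnorm (x + y) = quat_sqnorm x + dot *+ 2 + quat_sqnorm y.
  by rewrite /quat_sqnorm /dot /=; ring.
rewrite lerD2r lerD2l lerMn2r /=.
apply: (le_trans (ler_norm _)); rewrite -sqrtr_sqr ler_wsqrtr//.
rewrite -subr_ge0.
have -> : quat_sqnorm x * quat_sqnorm y - dot ^+ 2 =
  (q0 x * q1 y - q1 x * q0 y) ^+ 2 + (q0 x * q2 y - q2 x * q0 y) ^+ 2
  + (q0 x * q3 y - q3 x * q0 y) ^+ 2 + (q1 x * q2 y - q2 x * q1 y) ^+ 2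
  + (q1 x * q3 y - q3 x * q1 y) ^+ 2 + (q2 x * q3 y - q3 x * q2 y) ^+ 2.
  by rewrite /quat_sqnorm /dot; ring.
by rewrite !addr_ge0 ?sqr_ge0.
Qed.
Fact quat_normZ (l : R) (x : H) : quat_norm (l *: x) = `|l| * quat_norm x.
Proof.
rewrite /quat_norm -sqrtr_sqr -sqrtrM ?sqr_ge0//; congr Num.sqrt.
by rewrite /quat_sqnorm /=; ring.
Qed.
Fact quat_norm0_eq0 x : quat_norm x = 0 -> x = 0.
Proof.
move=> /eqP; rewrite sqrtr_eq0 => h; apply/eqP.
by rewrite -quat_sqnorm_eq0 eq_le h quat_sqnorm_ge0.
Qed.

HB.instance Definition _ :=
  Lmodule_isNormed.Build R H quat_normD quat_normZ quat_norm0_eq0.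

Lemma quat_normE (q : H) :
  `|q| = Num.sqrt (q0 q ^+ 2 + q1 q ^+ 2 + q2 q ^+ 2 + q3 q ^+ 2).
Proof. by []. Qed.

Definition quat_im (q : H) : H := Quat 0 (q1 q) (q2 q) (q3 q).

Definition sphereS2 : set H := [set i | q0 i = 0 /\ `|i| = 1].

Definition slice_pt (i : H) (x y : R) : H := x%:A + y *: i.

Definition slice_plane (i : H) : set H :=
  [set q | exists x y, q = slice_pt i x y].

Definition qball : set H := [set q | `|q| < 1].

Definition slit_qball : set H :=
  qball `\` [set q | exists x : R, -1 < x <= 0 /\ q = x%:A].

(* Slice regularity of the restriction to (the open set) Omega of a total
   function; only the values on Omega matter. *)
Definition slice_regular (Omega : set H) (f : H -> H) : Prop :=
  (forall q, Omega q -> differentiable f q) /\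
  (forall i, sphereS2 i -> forall x y : R, Omega (slice_pt i x y) ->
     derive1 (fun t => f (slice_pt i t y)) x
     + i * derive1 (fun t => f (slice_pt i x t)) y = 0).

(* The principal power: with theta in ]-pi, pi[ and I in S^2,
   (r (cos theta + I sin theta))^a = r^a (cos (a theta) + I sin (a theta)),
   see [qpow_polar].  The polar form used here takes I := Im q / |Im q| and
   theta := acos (Re q / |q|) in [0, pi[; if q > 0 then theta = 0 and
   I is irrelevant. *)
Definition qarg (q : H) : R := acos (q0 q / `|q|).

Definition qpow (q : H) (a : R) : H :=
  (`|q| `^ a) *: ((cos (a * qarg q))%:A +
    sin (a * qarg q) *: (`|quat_im q|^-1 *: quat_im q)).

Definition exp_trunc (k : nat) (q : H) : H :=
  \sum_(n < k.+1) (n`!%:R^-1 : R) *: q ^+ n.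

Definition slit_slice (i : H) : set H := slit_qball `&` slice_plane i.

Definition dsigma (a s : R) (k : nat) (i : H) (f : H -> H) (z : H) : H :=
  (1 - s) *: f z +
  s *: lim ((exp_trunc k (qpow z a) - exp_trunc k (qpow w a))^-1
              * (f z - f w) @[w --> within (slit_slice i) (z^')]).

(* The area measure on C(i) is the Lebesgue measure of R^2 transported by
   (x, y) |-> x + i y. *)
Definition area_measure :=
  (@lebesgue_measure R \x @lebesgue_measure R)%E.

Definition dirichlet_sqnorm (a s : R) (k : nat) (i : H) (f : H -> H) : \bar R :=
  ((a * `|f ((2^-1 : R)%:A)| ^+ 2)%:E +
   \int[area_measure]_(p in [set p | slit_slice i (slice_pt i p.1 p.2)])
     (`|dsigma a s k i f (slice_pt i p.1 p.2)| ^+ 2)%:E)%E.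

Definition dirichlet_space (a s : R) (k : nat) (i : H) : set (H -> H) :=
  [set f | slice_regular slit_qball f /\
           (dirichlet_sqnorm a s k i f < +oo)%E].

Lemma qpow_polar (I : H) (r theta a : R) :
  sphereS2 I -> 0 < r -> - pi < theta < pi ->
  qpow (r *: slice_pt I (cos theta) (sin theta)) a =
  (r `^ a) *: slice_pt I (cos (a * theta)) (sin (a * theta)).
Proof.
move=> [I0 nI] r0 /andP[h1 h2].
have im0 : quat_im I = I by apply: quatP => //=; rewrite I0.
have sI : quat_sqnorm I = 1.
  by rewrite -[LHS]sqr_sqrtr ?quat_sqnorm_ge0// -[Num.sqrt _]/(`|I|) nI expr1n.
have nQ : `|r *: slice_pt I (cos theta) (sin theta)| = r.
  rewrite normrZ gtr0_norm// -[RHS]mulr1; congr (_ * _).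
  rewrite -[LHS]/(Num.sqrt _) -[RHS]sqrtr1; congr Num.sqrt.
  have := cos2Dsin2 theta; move: sI; rewrite /quat_sqnorm /= I0 => sI cs.
  transitivity (cos theta ^+ 2 + sin theta ^+ 2 *
      (0 ^+ 2 + q1 I ^+ 2 + q2 I ^+ 2 + q3 I ^+ 2)); first by ring.
  by rewrite sI mulr1.
have aQ : qarg (r *: slice_pt I (cos theta) (sin theta)) = `|theta|.
  rewrite /qarg nQ /= I0 mulr1 mulr0 addr0 mulrAC divff ?gt_eqF// mul1r.
  rewrite -[cos theta](_ : cos `|theta| = _); last first.
    by case: ler0P => // _; rewrite cosN.
  rewrite cosK// in_itv/= normr_ge0/=.
  by rewrite ler_norml; apply/andP; split; apply: ltW.
have iQ : quat_im (r *: slice_pt I (cos theta) (sin theta)) =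
    (r * sin theta) *: I.
  by apply: quatP => /=; rewrite ?I0; ring.
rewrite /qpow nQ aQ iQ normrZ nI mulr1 scalerA; congr (_ *: _).
rewrite /slice_pt scalerA; case: (ltrgt0P theta) => ht.
- have s0 : 0 < sin theta by apply: sin_gt0_pi; rewrite ?ht.
  have rs : r * sin theta != 0 by rewrite mulf_neq0// gt_eqF.
  by rewrite gtr0_norm ?mulr_gt0// -mulrA mulVf// mulr1.
- have s0 : sin theta < 0.
    by rewrite -oppr_gt0 -sinN sin_gt0_pi// ?oppr_gt0 ?ht//= ltrNl.
  have rs : r * sin theta != 0 by rewrite mulf_neq0 ?(gt_eqF r0) ?(lt_eqF s0).
  rewrite ltr0_norm ?pmulr_rlt0// invrN -mulrA mulNr mulVf//.
  by rewrite !mulrN cosN sinN mulr1 opprK.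
- by rewrite ht !mulr0 sin0 cos0 !mul0r.
Qed.

End quaternions.

Arguments sphereS2 {R}.
Arguments qball {R}.
Arguments slit_qball {R}.

(* Main.v *)
Require Import Defs.
From HB Require Import structures.
From mathcomp Require Import all_boot all_order all_algebra.
From mathcomp Require Import ring lra.
From mathcomp Require Import all_classical all_reals all_analysis.
From mathcomp Require Import measurable_realfun.

(** The two norms are compared pointwise.  A slice regular function on the ball
    is determined by its values on one slice through the representation formula
    f (x + j y) = 1/2 (1 - j i) f (x + i y) + 1/2 (1 + j i) f (x - i y).
    Differentiating in x gives the same formula for the derivative of f along
    the slices.  In a slice the operator of the norm is
    (1 - sigma) f + sigma w^-1 f', where w is the derivative of e_k (z^alpha)
    ([dsigmaE]).  The value w (x + i y) has the form c + i d with real c and d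
    that do not depend on i, and j (1 - j i) = (1 - j i) i, so w^-1 passes
    through the coefficients and the operator satisfies the representation
    formula as well ([dsigma_rep]).  The coefficients have modulus at most 1,
    hence the squared modulus of the operator at x + j y is at most twice the
    sum of its squared moduli at x + i y and x - i y ([dsigma_rep_le]).  The
    slit disc and the area are invariant under conjugation, so integration gives
    the factor 4 for the integrals; the terms at 1/2 are equal because 1/2 is
    real.

    The representation formula is a statement of unique continuation: both sides
    are holomorphic in the same sense and agree on the real axis.  Since slice
    regular functions are only assumed differentiable, this is derived from
    Goursat's theorem ([goursat]), proved by bisection.  Instead of passing
    through power series, Goursat's theorem is applied on a thin rectangle
    standing on the real axis to the function multiplied by the entire weight
    exp (N cos (k (z - w))), whose modulus is 1 on the lateral sides and which
    concentrates at w on the top side as N grows ([cr_unique], [peak_zero]).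

    The integrals are linear only on measurable functions.  The derivative of f
    is not known to be continuous at this stage, but it is a pointwise limit of
    difference quotients ([measurable_partial], [measurable_dsigma]). *)

Set Implicit Arguments.
Unset Strict Implicit.
Unset Printing Implicit Defensive.
Import Order.TTheory GRing.Theory Num.Theory.
Import numFieldNormedType.Exports.
Local Open Scope classical_set_scope.
Local Open Scope ring_scope.

(** * Integrals over segments *)

Section segment_integral.
Variable R : realType.
Local Notation mu := (@lebesgue_measure R).
Implicit Types (g : R -> R) (a b : R).

Definition segint a b g : R := \int[mu]_(x in `[a, b]) g x.

(** Continuity is two-sided at the endpoints too: the functions integrated here
    are restrictions of functions that are continuous at points of the plane. *)
Definition cont_on a b g := forall x, a <= x <= b -> {for x, continuous g}.

Lemma cont_on_integrable a b g : cont_on a b g ->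
  mu.-integrable `[a, b] (EFin \o g).
Proof.
move=> cg; apply: continuous_compact_integrable; first exact: segment_compact.
apply: continuous_in_subspaceT => x; rewrite inE /= in_itv /=; exact: cg.
Qed.

Lemma cont_onS a b c d g : a <= c -> d <= b -> cont_on a b g -> cont_on c d g.
Proof. by move=> ac db cg x /andP[cx xd]; apply: cg; lra. Qed.

Lemma segintD a b f g : cont_on a b f -> cont_on a b g ->
  segint a b (fun x => f x + g x) = segint a b f + segint a b g.
Proof.
by move=> cf cg; rewrite /segint RintegralD//; exact: cont_on_integrable.
Qed.

Lemma segintN (a b : R) g : cont_on a b g ->
  segint a b (fun x => - g x) = - segint a b g.
Proof.
move=> cg; rewrite /segint -[RHS]mulN1r -RintegralZl//; last first.
  exact: cont_on_integrable.
by apply: eq_Rintegral => x _; rewrite mulN1r.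
Qed.

Lemma eq_segint (a b : R) f g : (forall x, a <= x <= b -> f x = g x) ->
  segint a b f = segint a b g.
Proof.
move=> fg; apply: eq_Rintegral => x; rewrite inE /= in_itv /=; exact: fg.
Qed.

Lemma segint_split a m b g : a <= m <= b -> cont_on a b g ->
  segint a b g = segint a m g + segint m b g.
Proof.
move=> /andP[am mb] cg; have ig := cont_on_integrable cg.
apply/eqP; rewrite addrC -subr_eq; apply/eqP.
rewrite /segint Rintegral_itvB ?bnd_simp//.
rewrite Rintegral_itv_obnd_cbnd//.
apply: integrableS ig => //; apply: subset_itvr; by rewrite bnd_simp.
Qed.

Lemma segint_cst a b k : a <= b -> segint a b (fun=> k) = k * (b - a).
Proof.
move=> ab; rewrite /segint Rintegral_cst//.
rewrite [X in fine X]lebesgue_measure_itv/= lte_fin.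
move: ab; rewrite le_eqVlt => /predU1P[->|ab]; last by rewrite ab.
by rewrite ltxx subrr.
Qed.

Lemma segint_le a b f g : cont_on a b f -> cont_on a b g ->
  (forall x, a <= x <= b -> f x <= g x) -> segint a b f <= segint a b g.
Proof.
move=> cf cg fg; apply: le_Rintegral => //; try exact: cont_on_integrable.
Qed.

Lemma segint_near_cst a b g k e : a <= b -> cont_on a b g ->
  (forall x, a <= x <= b -> `|g x - k| <= e) ->
  `|segint a b g - k * (b - a)| <= e * (b - a).
Proof.
move=> ab cg H.
have cc r : cont_on a b (fun=> r) by move=> x _; exact: cst_continuous.
have h1 : segint a b g <= segint a b (fun=> k + e).
  by apply: segint_le => // x /H; rewrite ler_norml; lra.
have h2 : segint a b (fun=> k - e) <= segint a b g.
  by apply: segint_le => // x /H; rewrite ler_norml; lra.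
by move: h1 h2; rewrite !segint_cst// ler_norml => h1 h2; lra.
Qed.

End segment_integral.

(** * Goursat's theorem on rectangles *)

Lemma is_diff_near (R : realType) (V W : normedModType R) (F dF : V -> W) p :
  is_diff p F dF -> forall e, 0 < e -> exists2 d, 0 < d &
    forall q, `|q - p| < d -> `|F q - F p - dF (q - p)| <= e * `|q - p|.
Proof.
move=> dFp e e0; have dp : differentiable F p by [].
have [_] := (diff_locallyP _ _).1 dp.
rewrite diff_val => /eqaddoP /(_ e e0) /nbhs_normP [d /= d0 H].
exists d => // q qp; have := H (q - p).
rewrite /= /ball_ /= sub0r normrN => /(_ qp).
by rewrite !fctE /= subrK opprD addrA.
Qed.

Lemma nested_intervals (R : realType) (u l : nat -> R) :
  (forall n, u n <= u n.+1) -> (forall n, u n.+1 + l n.+1 <= u n + l n) ->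
  (forall n, 0 <= l n) -> exists x, forall n, u n <= x <= u n + l n.
Proof.
move=> iu du l0.
have mu : {homo u : m n / (m <= n)%N >-> m <= n}.
  exact/nondecreasing_seqP.
have md m n : (m <= n)%N -> u n + l n <= u m + l m.
  by have /nonincreasing_seqP := du; apply.
have ub n : ubound (range u) (u n + l n).
  move=> _ [m _ <-]; apply: (le_trans (mu _ _ (leq_maxl m n))).
  by apply: le_trans (md _ _ (leq_maxr m n)); rewrite lerDl.
exists (sup (range u)) => n; apply/andP; split.
  by apply: ub_le_sup; [exists (u 0%N + l 0%N)|exists n].
by apply: ge_sup => //; exists (u 0%N); exists 0%N.
Qed.

Section goursat.
Variable R : realType.
Implicit Types (P Q : R * R -> R) (a b c d : R).

(** The integral of P dx + Q dy along the boundary of a rectangle.  Opposite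
    sides share one integral, so that an affine closed form contributes
    constant integrands that visibly cancel. *)
Definition circulation P Q a b c d :=
  segint a b (fun x => P (x, c) - P (x, d)) +
  segint c d (fun y => Q (b, y) - Q (a, y)).

(** The form P dx + Q dy is closed at p.  Slice regular functions are only
    assumed differentiable, so the partial derivatives are taken at the single
    point p and are not assumed continuous. *)
Definition closed_at P Q p := exists A B C : R,
  is_diff p P (fun h => A * h.1 + C * h.2) /\
  is_diff p Q (fun h => C * h.1 + B * h.2).

Definition in_rect a b c d (p : R * R) := a <= p.1 <= b /\ c <= p.2 <= d.

Lemma cont_slice1 (F : R * R -> R) (x y : R) : {for (x, y), continuous F} ->
  {for x, continuous (fun t => F (t, y))}.
Proof.
move=> cF; apply: (@continuous_comp _ _ _ (fun t => (t, y)) F) => //.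
exact: (cvg_pair cvg_id (cvg_cst _)).
Qed.

Lemma cont_slice2 (F : R * R -> R) (x y : R) : {for (x, y), continuous F} ->
  {for y, continuous (fun t => F (x, t))}.
Proof.
move=> cF; apply: (@continuous_comp _ _ _ (fun t => (x, t)) F) => //.
exact: (cvg_pair (cvg_cst _) cvg_id).
Qed.

Lemma cont_on_top P a b c d : a <= b -> c <= d ->
  (forall p, in_rect a b c d p -> {for p, continuous P}) ->
  cont_on a b (fun x => P (x, c) - P (x, d)).
Proof.
move=> ab cd cP x xab; apply: continuousB; apply: cont_slice1;
  by apply: cP; split=> //=; lra.
Qed.

Lemma cont_on_side Q a b c d : a <= b -> c <= d ->
  (forall p, in_rect a b c d p -> {for p, continuous Q}) ->
  cont_on c d (fun y => Q (b, y) - Q (a, y)).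
Proof.
move=> ab cd cP x xab; apply: continuousB; apply: cont_slice2;
  by apply: cP; split=> //=; lra.
Qed.

Lemma circulation_split P Q a m b c n d : a <= m <= b -> c <= n <= d ->
  (forall p, in_rect a b c d p -> {for p, continuous P}) ->
  (forall p, in_rect a b c d p -> {for p, continuous Q}) ->
  circulation P Q a b c d =
    circulation P Q a m c n + circulation P Q m b c n +
    (circulation P Q a m n d + circulation P Q m b n d).
Proof.
move=> /andP[am mb] /andP[cn nd] cP cQ.
have S (F : R * R -> R) a' b' c' d' :
    a <= a' -> b' <= b -> c <= c' -> d' <= d ->
    (forall p, in_rect a b c d p -> {for p, continuous F}) ->
    forall p, in_rect a' b' c' d' p -> {for p, continuous F}.
  by move=> h1 h2 h3 h4 cF p [/andP[? ?] /andP[? ?]]; apply: cF; split; lra.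
have splitx a' b' c' d' m' : a <= a' -> a' <= m' <= b' -> b' <= b ->
    c <= c' -> c' <= d' -> d' <= d -> circulation P Q a' b' c' d' =
    circulation P Q a' m' c' d' + circulation P Q m' b' c' d'.
  move=> h1 /andP[h2 h2'] h3 h4 h5 h6; rewrite /circulation.
  rewrite (@segint_split _ a' m' b'); last 2 first.
  - by rewrite h2.
  - by apply: cont_on_top; rewrite ?(le_trans h2)//; apply: S cP.
  have -> : (fun y => Q (b', y) - Q (a', y)) =
     (fun y => (Q (b', y) - Q (m', y)) + (Q (m', y) - Q (a', y))).
    by apply/funext => y; ring.
  rewrite (@segintD _ c' d'); last 2 first.
  - by apply: cont_on_side => //; apply: S cQ => //; lra.
  - by apply: cont_on_side => //; apply: S cQ => //; lra.
  ring.
have splity a' b' c' d' m' : a <= a' -> a' <= b' -> b' <= b ->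
    c <= c' -> c' <= m' <= d' -> d' <= d -> circulation P Q a' b' c' d' =
    circulation P Q a' b' c' m' + circulation P Q a' b' m' d'.
  move=> h1 h2 h3 h4 /andP[h5 h5'] h6; rewrite /circulation.
  rewrite (@segint_split _ c' m' d'); last 2 first.
  - by rewrite h5.
  - by apply: cont_on_side; rewrite ?(le_trans h5)//; apply: S cQ.
  have -> : (fun x => P (x, c') - P (x, d')) =
     (fun x => (P (x, c') - P (x, m')) + (P (x, m') - P (x, d'))).
    by apply/funext => y; ring.
  rewrite (@segintD _ a' b'); last 2 first.
  - by apply: cont_on_top => //; apply: S cP => //; lra.
  - by apply: cont_on_top => //; apply: S cP => //; lra.
  ring.
rewrite (splity _ _ _ _ n); try lra.
rewrite (splitx _ _ c n m); try lra.
rewrite (splitx _ _ n d m); try lra.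
Qed.

(** The affine part of (P, Q) at p is a closed form and does not circulate; the
    remainder is small compared with the diameter and is integrated along a
    boundary whose length is of the order of the diameter. *)
Lemma circulation_small P Q p : closed_at P Q p -> forall e, 0 < e ->
  exists2 r, 0 < r & forall a b c d, in_rect a b c d p ->
    b - a < r -> d - c < r ->
    (forall p, in_rect a b c d p -> {for p, continuous P}) ->
    (forall p, in_rect a b c d p -> {for p, continuous Q}) ->
    `|circulation P Q a b c d| <= e * ((b - a) + (d - c)) ^+ 2.
Proof.
move=> [A [B [C [dP dQ]]]] e e0.
have e40 : 0 < e / 4 by lra.
have [r1 r10 H1] := is_diff_near dP e40.
have [r2 r20 H2] := is_diff_near dQ e40.
exists (Num.min r1 r2); first by rewrite lt_min r10.
move=> a b c d [/andP[ap pb] /andP[cp pd]]; rewrite !lt_min.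
move=> /andP[ba1 ba2] /andP[dc1 dc2] cP cQ.
have ab : a <= b by lra.
have cd : c <= d by lra.
have N (q : R * R) : in_rect a b c d q -> `|q - p| <= Num.max (b - a) (d - c).
  move=> [/andP[? ?] /andP[? ?]]; rewrite prod_normE /= ge_max !le_max.
  by apply/andP; split; apply/orP; [left|right]; rewrite ler_norml; lra.
set D := Num.max (b - a) (d - c) in N.
have DD : D <= (b - a) + (d - c) by rewrite /D ge_max; lra.
have D1 : D < r1 by rewrite /D gt_max ba1.
have D2 : D < r2 by rewrite /D gt_max ba2.
have E1 q : in_rect a b c d q ->
    `|P q - P p - (A * (q - p).1 + C * (q - p).2)| <= e / 4 * D.
  move=> /N qD; apply: (le_trans (H1 _ _)); first exact: le_lt_trans D1.
  by rewrite ler_pM2l.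
have E2 q : in_rect a b c d q ->
    `|Q q - Q p - (C * (q - p).1 + B * (q - p).2)| <= e / 4 * D.
  move=> /N qD; apply: (le_trans (H2 _ _)); first exact: le_lt_trans D2.
  by rewrite ler_pM2l.
have /= := @segint_near_cst _ a b _ (C * (c - d)) (e / 2 * D) ab
  (cont_on_top ab cd cP).
have /= := @segint_near_cst _ c d _ (C * (b - a)) (e / 2 * D) cd
  (cont_on_side ab cd cQ).
rewrite -/(circulation _ _ _ _ _ _).
set X := segint a b _; set Y := segint c d _.
move=> hY hX.
have {}hY : `|Y - C * (b - a) * (d - c)| <= e / 2 * D * (d - c).
  apply: hY => y ycd.
  have e1 := E2 (b, y); have e2 := E2 (a, y).
  rewrite /in_rect /= in e1 e2.
  have {}e1 := e1 (conj _ ycd); have {}e2 := e2 (conj _ ycd).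
  have {}e1 : `|Q (b, y) - Q p - (C * (b - p.1) + B * (y - p.2))| <= e / 4 * D.
    by apply: e1; lra.
  have {}e2 : `|Q (a, y) - Q p - (C * (a - p.1) + B * (y - p.2))| <= e / 4 * D.
    by apply: e2; lra.
  by move: e1 e2; rewrite !ler_norml; lra.
have {}hX : `|X - C * (c - d) * (b - a)| <= e / 2 * D * (b - a).
  apply: hX => x xab.
  have e1 := E1 (x, c); have e2 := E1 (x, d).
  rewrite /in_rect /= in e1 e2.
  have {}e1 := e1 (conj xab _); have {}e2 := e2 (conj xab _).
  have {}e1 : `|P (x, c) - P p - (A * (x - p.1) + C * (c - p.2))| <= e / 4 * D.
    by apply: e1; lra.
  have {}e2 : `|P (x, d) - P p - (A * (x - p.1) + C * (d - p.2))| <= e / 4 * D.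
    by apply: e2; lra.
  by move: e1 e2; rewrite !ler_norml; lra.
have -> : circulation P Q a b c d =
   (X - C * (c - d) * (b - a)) + (Y - C * (b - a) * (d - c)).
  by rewrite /circulation -/X -/Y; ring.
apply: (le_trans (ler_normD _ _)); apply: (le_trans (lerD hX hY)).
rewrite -mulrDr expr2 mulrA ler_wpM2r//; first lra.
apply: (@le_trans _ _ (e / 2 * (b - a + (d - c)))).
  by rewrite ler_pM2l//; lra.
by rewrite ler_wpM2r//; lra.
Qed.

Lemma closed_at_continuous P Q p : closed_at P Q p ->
  {for p, continuous P} /\ {for p, continuous Q}.
Proof.
by move=> [A [B [C [dP dQ]]]]; split; apply: differentiable_continuous.
Qed.

(** Bisection.  One of the four quarters of the rectangle carries at least a
    quarter of the circulation, and so on; after n steps at least 4^-n times the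
    initial circulation is left, which is of the order of the area.  By
    circulation_small at the common point of the nested rectangles the ratio to
    the area becomes arbitrarily small, so the circulation is zero. *)
Lemma goursat P Q a b c d : a <= b -> c <= d ->
  (forall p, in_rect a b c d p -> closed_at P Q p) ->
  circulation P Q a b c d = 0.
Proof.
move=> ab cd cPQ.
have cP p : in_rect a b c d p -> {for p, continuous P}.
  by move=> /cPQ /closed_at_continuous[].
have cQ p : in_rect a b c d p -> {for p, continuous Q}.
  by move=> /cPQ /closed_at_continuous[].
pose w n : R := (b - a) / 2 ^+ n; pose h n : R := (d - c) / 2 ^+ n.
have w2 n : w n = w n.+1 + w n.+1.
  rewrite /w exprS; field; by rewrite expf_neq0.
have h2 n : h n = h n.+1 + h n.+1.
  rewrite /h exprS; field; by rewrite expf_neq0.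
have w0 n : 0 <= w n by rewrite divr_ge0 ?exprn_ge0// subr_ge0.
have h0 n : 0 <= h n by rewrite divr_ge0 ?exprn_ge0// subr_ge0.
pose inr n (p : R * R) :=
  (a <= p.1 /\ p.1 + w n <= b) /\ (c <= p.2 /\ p.2 + h n <= d).
pose S n (p : R * R) := circulation P Q p.1 (p.1 + w n) p.2 (p.2 + h n).
pose good n (p q : R * R) := [/\ inr n.+1 q,
  p.1 <= q.1 /\ q.1 + w n.+1 <= p.1 + w n,
  p.2 <= q.2 /\ q.2 + h n.+1 <= p.2 + h n &
  `|S n p| <= 4 * `|S n.+1 q| ].
have step (np : nat * (R * R)) :
    exists q, inr np.1 np.2 -> good np.1 np.2 q.
  case: np => n p /=; have [pin|pout] := pselect (inr n p); last first.
    by exists p => /pout.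
  have [[p1 p2] [p3 p4]] := pin.
  have wn := w2 n; have hn := h2 n; have wn0 := w0 n.+1; have hn0 := h0 n.+1.
  have I1 : inr n.+1 p /\ p.1 <= p.1 /\ p.1 + w n.+1 <= p.1 + w n /\
      p.2 <= p.2 /\ p.2 + h n.+1 <= p.2 + h n.
    by rewrite /inr; repeat split; lra.
  pose pr := (p.1 + w n.+1, p.2); pose pu := (p.1, p.2 + h n.+1).
  pose pru := (p.1 + w n.+1, p.2 + h n.+1).
  have I2 : inr n.+1 pr /\ p.1 <= pr.1 /\ pr.1 + w n.+1 <= p.1 + w n /\
      p.2 <= pr.2 /\ pr.2 + h n.+1 <= p.2 + h n.
    by clear -p1 p2 p3 p4 wn hn wn0 hn0; rewrite /inr; repeat split => /=; lra.
  have I3 : inr n.+1 pu /\ p.1 <= pu.1 /\ pu.1 + w n.+1 <= p.1 + w n /\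
      p.2 <= pu.2 /\ pu.2 + h n.+1 <= p.2 + h n.
    by clear -p1 p2 p3 p4 wn hn wn0 hn0; rewrite /inr; repeat split => /=; lra.
  have I4 : inr n.+1 pru /\ p.1 <= pru.1 /\ pru.1 + w n.+1 <= p.1 + w n /\
      p.2 <= pru.2 /\ pru.2 + h n.+1 <= p.2 + h n.
    by clear -p1 p2 p3 p4 wn hn wn0 hn0; rewrite /inr; repeat split => /=; lra.
  have : exists q, good n p q; last by case=> q; exists q.
  have E : S n p = S n.+1 p + S n.+1 pr + (S n.+1 pu + S n.+1 pru).
    rewrite /S /= (@circulation_split P Q _ (p.1 + w n.+1) _ _ (p.2 + h n.+1)).
    - by rewrite -!addrA -wn -hn.
    - by rewrite lerDl wn0; case: I1 => _ [_ []].
    - by rewrite lerDl hn0; case: I1 => _ [_ [_ []]].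
    - by move=> q [? ?]; apply: cP; split; lra.
    - by move=> q [? ?]; apply: cQ; split; lra.
  (* otherwise the four quarters together circulate less than the rectangle *)
  apply: contrapT => H.
  have K q : (inr n.+1 q /\ p.1 <= q.1 /\ q.1 + w n.+1 <= p.1 + w n /\
      p.2 <= q.2 /\ q.2 + h n.+1 <= p.2 + h n) -> 4 * `|S n.+1 q| < `|S n p|.
    move=> [q1 [q2 [q3 [q4 q5]]]]; rewrite ltNge; apply/negP => q6; apply: H.
    by exists q.
  have := ler_normD (S n.+1 p + S n.+1 pr) (S n.+1 pu + S n.+1 pru).
  have := ler_normD (S n.+1 p) (S n.+1 pr).
  have := ler_normD (S n.+1 pu) (S n.+1 pru).
  rewrite -E; move: (K _ I1) (K _ I2) (K _ I3) (K _ I4); clear; lra.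
have [next nextP] := choice step.
pose r := fix r n := if n is m.+1 then next (m, r m) else (a, c).
have rin n : inr n (r n).
  elim: n => [|n IH].
    by rewrite /inr /= /w /h expr0 !divr1; repeat split; lra.
  by have [] := nextP (n, r n) IH.
have rgood n : good n (r n) (r n.+1) := nextP (n, r n) (rin n).
have [x xP] : exists x, forall n, (r n).1 <= x <= (r n).1 + w n.
  by apply: nested_intervals => // n; case: (rgood n) => _ [].
have [y yP] : exists y, forall n, (r n).2 <= y <= (r n).2 + h n.
  by apply: nested_intervals => // n; case: (rgood n) => _ _ [].
have circ4 n : `|circulation P Q a b c d| <= 4 ^+ n * `|S n (r n)|.
  elim: n => [|n IH].
    rewrite expr0 mul1r /S /= /w /h expr0 !divr1.
    by rewrite [a + _]addrC [c + _]addrC !subrK.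
  apply: (le_trans IH); rewrite exprSr -mulrA ler_pM2l ?exprn_gt0//.
  by case: (rgood n).
apply/eqP; rewrite -normr_le0; apply/ler_addgt0Pl => e e0; rewrite addr0.
have pin : in_rect a b c d (x, y).
  have := xP 0%N; have := yP 0%N; rewrite /= /w /h expr0 !divr1.
  by split => /=; lra.
(* the summand 1 keeps M positive when the rectangle is reduced to a point *)
pose M := ((b - a) + (d - c)) ^+ 2 + 1.
have M0 : 0 < M by rewrite /M ltr_wpDl ?sqr_ge0.
have [rho rho0 H] := circulation_small (cPQ _ pin) (divr_gt0 e0 M0).
have [n n1] : exists n, w n < rho /\ h n < rho.
  have [n nP] : exists n : nat, ((b - a) + (d - c)) / rho < 2 ^+ n.
    exists (Num.truncn (((b - a) + (d - c)) / rho)).+1.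
    apply: (lt_le_trans (truncnS_gt _)).
    by rewrite -natrX ler_nat ltnW// ltn_expl.
  exists n; move: nP; rewrite ltr_pdivrMr// => nP.
  by split; rewrite ltr_pdivrMr ?exprn_gt0// mulrC; lra.
apply: (le_trans (circ4 n)).
have {}H : `|S n (r n)| <= e / M * (w n + h n) ^+ 2.
  have [[r1 r2] [r3 r4]] := rin n.
  have [n1w n1h] := n1.
  have Dw : (r n).1 + w n - (r n).1 = w n by rewrite addrC addKr.
  have Dh : (r n).2 + h n - (r n).2 = h n by rewrite addrC addKr.
  rewrite -[X in (X + _) ^+ 2]Dw -[X in (_ + X) ^+ 2]Dh; apply: H.
  - by split.
  - by rewrite Dw.
  - by rewrite Dh.
  - move=> q [/andP[q1 q2] /andP[q3 q4]]; apply: cP; split; apply/andP; split.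
    + exact: le_trans q1.
    + exact: le_trans r2.
    + exact: le_trans q3.
    + exact: le_trans r4.
  - move=> q [/andP[q1 q2] /andP[q3 q4]]; apply: cQ; split; apply/andP; split.
    + exact: le_trans q1.
    + exact: le_trans r2.
    + exact: le_trans q3.
    + exact: le_trans r4.
apply: (le_trans (ler_wpM2l _ H)); first exact: exprn_ge0.
have -> : 4 ^+ n * (e / M * (w n + h n) ^+ 2) =
    e * (((b - a) + (d - c)) ^+ 2 / M).
  rewrite /w /h (_ : 4 = 2 ^+ 2 :> R); last by ring.
  rewrite -exprM mulnC exprM.
  by field; rewrite (gt_eqF M0) expf_neq0.
rewrite ger_pMr// ler_pdivrMr// mul1r /M; lra.
Qed.

End goursat.

(** * Cauchy-Riemann pairs *)

Section cauchy_riemann.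
Variable R : realType.
Implicit Types (u v a b : R * R -> R) (p : R * R).

(** u + i v is differentiable at p with complex derivative A + i B. *)
Definition cr_pair u v p (A B : R) :=
  is_diff p u (fun h => A * h.1 - B * h.2) /\
  is_diff p v (fun h => B * h.1 + A * h.2).

Lemma is_diff_comp_derive (V : normedModType R) (u : V -> R) du
    (f : R -> R) (d : R) (p : V) :
  is_diff p u du -> is_derive (u p) 1 f d ->
  is_diff p (fun z => f (u z)) (fun h => du h * d).
Proof.
move=> Hu Hf.
have df : differentiable f (u p) by apply/derivable1_diffP; exact: ex_derive.
have H : is_diff (u p) f ('d f (u p)) by exact: differentiableP.
apply: (@is_diff_eq _ _ _ _ _ _ _ (is_diff_comp Hu H)).
apply/funext => h /=; rewrite diff1E// derive1E.
by have [_ ->] := Hf.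
Qed.

Lemma cr_ext u v u' v' p A B A' B' : u' = u -> v' = v -> A' = A -> B' = B ->
  cr_pair u v p A B -> cr_pair u' v' p A' B'.
Proof. by move=> -> -> -> ->. Qed.

Lemma crD u v a b p A B C D : cr_pair u v p A B -> cr_pair a b p C D ->
  cr_pair (fun z => u z + a z) (fun z => v z + b z) p (A + C) (B + D).
Proof.
move=> [du dv] [da db]; split.
  apply: (is_diff_eq (is_diffD du da)); apply/funext => h; rewrite !fctE; ring.
apply: (is_diff_eq (is_diffD dv db)); apply/funext => h; rewrite !fctE; ring.
Qed.

Lemma crM u v a b p A B C D : cr_pair u v p A B -> cr_pair a b p C D ->
  cr_pair (fun z => u z * a z - v z * b z) (fun z => u z * b z + v z * a z) p
    (A * a p - B * b p + (u p * C - v p * D))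
    (A * b p + B * a p + (u p * D + v p * C)).
Proof.
move=> [du dv] [da db]; split.
  apply: (is_diff_eq (is_diffB (is_diffM du da) (is_diffM dv db))).
  by apply/funext => h; rewrite !fctE /= /GRing.scale /=; ring.
apply: (is_diff_eq (is_diffD (is_diffM du db) (is_diffM dv da))).
by apply/funext => h; rewrite !fctE /= /GRing.scale /=; ring.
Qed.

Lemma crZ u v p A B k : cr_pair u v p A B ->
  cr_pair (fun z => k * u z) (fun z => k * v z) p (k * A) (k * B).
Proof.
move=> [du dv]; split.
  apply: (is_diff_eq (is_diffZ k du)).
  by apply/funext => h; rewrite !fctE /= /GRing.scale /=; ring.
apply: (is_diff_eq (is_diffZ k dv)).
by apply/funext => h; rewrite !fctE /= /GRing.scale /=; ring.
Qed.

Lemma crN u v p A B : cr_pair u v p A B ->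
  cr_pair (fun z => - u z) (fun z => - v z) p (- A) (- B).
Proof.
by move=> /(crZ (- 1)); apply: cr_ext; rewrite ?mulN1r//;
  apply/funext => z; rewrite mulN1r.
Qed.

(** The pair of exp (u + i v). *)
Lemma cr_exp u v p A B : cr_pair u v p A B ->
  cr_pair (fun z => expR (u z) * cos (v z)) (fun z => expR (u z) * sin (v z)) p
    (A * (expR (u p) * cos (v p)) - B * (expR (u p) * sin (v p)))
    (A * (expR (u p) * sin (v p)) + B * (expR (u p) * cos (v p))).
Proof.
move=> [du dv].
have de := is_diff_comp_derive du (is_derive_expR (u p)).
have dc := is_diff_comp_derive dv (is_derive_cos (v p)).
have ds := is_diff_comp_derive dv (is_derive_sin (v p)).
split.
  apply: (is_diff_eq (is_diffM de dc)).
  by apply/funext => h; rewrite !fctE /= /GRing.scale /=; ring.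
apply: (is_diff_eq (is_diffM de ds)).
by apply/funext => h; rewrite !fctE /= /GRing.scale /=; ring.
Qed.

Lemma is_diff_fst (p : R * R) : is_diff p (fun z : R * R => z.1) (fun h => h.1).
Proof.
have c : continuous (fst : R * R -> R) by move=> z; exact: cvg_fst.
by apply: DiffDef; [exact: linear_differentiable|rewrite diff_lin].
Qed.

Lemma is_diff_snd (p : R * R) : is_diff p (fun z : R * R => z.2) (fun h => h.2).
Proof.
have c : continuous (snd : R * R -> R) by move=> z; exact: cvg_snd.
by apply: DiffDef; [exact: linear_differentiable|rewrite diff_lin].
Qed.

(** The pair of - i k (z - w), where w = x0 + i y0. *)
Lemma cr_affine (x0 y0 k : R) p :
  cr_pair (fun z => k * (z.2 - y0)) (fun z => k * (x0 - z.1)) p 0 (- k).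
Proof.
have d1 : is_diff p (fun z : R * R => z.1) (fun h => h.1) := is_diff_fst p.
have d2 : is_diff p (fun z : R * R => z.2) (fun h => h.2) := is_diff_snd p.
split.
  apply: (is_diff_eq (is_diffZ k (is_diffB d2 (is_diff_cst y0 p)))).
  by apply/funext => h; rewrite subr0 !fctE /= /GRing.scale /=; ring.
apply: (is_diff_eq (is_diffZ k (is_diffB (is_diff_cst x0 p) d1))).
by apply/funext => h; rewrite sub0r !fctE /= /GRing.scale /=; ring.
Qed.

Lemma cr_closed u v p A B : cr_pair u v p A B -> closed_at u (fun z => - v z) p.
Proof.
move=> [du dv]; exists A, (- A), (- B); split.
  by apply: (is_diff_eq du); apply/funext => h; ring.
by apply: (is_diff_eq (is_diffN dv)); apply/funext => h; rewrite !fctE; ring.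
Qed.

End cauchy_riemann.

(** * Unique continuation from a horizontal segment *)

Section uniqueness.
Variable R : realType.
Implicit Types (u v : R * R -> R).

Lemma cont_on_bounded (a b : R) (g : R -> R) : a <= b -> cont_on a b g ->
  exists M, forall x, a <= x <= b -> `|g x| <= M.
Proof.
move=> ab cg.
have cn : {within `[a, b], continuous (fun x => `|g x|)}.
  apply: continuous_in_subspaceT => x; rewrite inE /= in_itv /= => xab.
  by apply: continuous_comp; [exact: cg|exact: norm_continuous].
have [c _ H] := EVT_max ab cn.
by exists `|g c| => x xab; apply: H; rewrite in_itv.
Qed.

Lemma cos_le (s t : R) : 0 <= s -> s <= t -> t <= pi -> cos t <= cos s.
Proof.
move=> s0 st tp; have [->//|ne] := eqVneq s t.
by apply: ltW; rewrite ltr_cos ?in_itv /=; rewrite ?lt_neqAle ?ne //; lra.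
Qed.

Lemma cont_on_peak (a b x0 k r : R) (g : R -> R) : cont_on a b g ->
  cont_on a b (fun x => g x * expR (r * cos (k * (x0 - x)))).
Proof.
move=> cg x xl; apply: continuousM; first exact: cg.
apply: (continuous_comp (f := fun x => r * cos (k * (x0 - x))));
  last exact: continuous_expR.
apply: continuousM; first exact: cst_continuous.
apply: (continuous_comp (f := fun x => k * (x0 - x))); last exact: continuous_cos.
apply: continuousM; first exact: cst_continuous.
by apply: continuousB; [exact: cst_continuous|].
Qed.

(** Laplace's method. The weight exp (N cos (k (x0 - x))) has its maximum at
    x0. If g x0 were positive, g would be at least g x0 / 2 near x0; then the
    part of the integral close to x0 would grow like exp (N a) and the part
    farther away at most like exp (N b) with b < a, so the integrals would not
    stay bounded. *)
Lemma peak_le0 (x0 l k C : R) (g : R -> R) : 0 < l -> k * l = pi / 2 ->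
  cont_on (x0 - l) (x0 + l) g ->
  (forall N : nat, `|segint (x0 - l) (x0 + l)
      (fun x => g x * expR (N%:R * cos (k * (x0 - x))))| <= C) ->
  g x0 <= 0.
Proof.
move=> l0 kl cg H; rewrite leNgt; apply/negP => g0.
have pi0 : 0 < pi :> R := pi_gt0 R.
have k0 : 0 < k.
  have : 0 < k * l by rewrite kl; lra.
  by rewrite pmulr_lgt0.
have x0l : x0 - l <= x0 + l by lra.
have [M HM] := cont_on_bounded x0l cg.
have M0 : 0 <= M by apply: le_trans (HM x0 _) => //; lra.
have [d d0 Hd] : exists2 d, 0 < d & forall x, `|x - x0| < d -> g x0 / 2 <= g x.
  have /cvgrPdist_lt /(_ (g x0 / 2)) : {for x0, continuous g} by apply: cg; lra.
  move=> /(_ ltac:(lra)) /nbhs_normP [d /= d0 Hd]; exists d => // x xd.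
  have := Hd x; rewrite /ball_ /= distrC => /(_ xd).
  by rewrite ltr_norml => /andP[]; lra.
pose m := Num.min d l.
have m0 : 0 < m by rewrite lt_min d0.
have [md ml] : m <= d /\ m <= l by rewrite !ge_min !lexx orbT.
pose e1 := m / 4; pose e2 := m / 2.
have [e10 e12 e2d e2l] : [/\ 0 < e1, e1 < e2, e2 < d & e2 < l].
  by rewrite /e1 /e2; split; lra.
pose a := cos (k * e1); pose b := cos (k * e2).
have kle s : s <= l -> k * s <= pi / 2 by move=> sl; rewrite -kl ler_pM2l.
have ke12 : k * e1 < k * e2 by rewrite ltr_pM2l.
have ke1 : 0 < k * e1 by rewrite mulr_gt0.
have ke2 : k * e2 <= pi / 2 by apply: kle; exact: ltW.
have ab : b < a by rewrite /a /b ltr_cos ?in_itv /=; lra.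
have b0 : 0 <= b by apply: cos_ge0_pihalf; lra.
have cosE x : cos (k * (x0 - x)) = cos (k * `|x - x0|).
  by rewrite -cos_norm normrM (gtr0_norm k0) distrC.
pose c := g x0 / 2 * (e1 + e1).
have c0 : 0 < c by rewrite /c; apply: mulr_gt0; lra.
have Hmain (N : nat) : c * expR (N%:R * (a - b)) <= C + 2 * l * M.
  have cw : cont_on (x0 - l) (x0 + l)
      (fun x => g x * expR (N%:R * cos (k * (x0 - x)))).
    exact: cont_on_peak.
  have cc lo hi (r : R) : cont_on lo hi (fun=> r).
    by move=> x _; exact: cst_continuous.
  have := H N; rewrite (@segint_split _ _ (x0 - e1) _ _ _ cw); last by lra.
  rewrite (@segint_split _ _ (x0 + e1) (x0 + l)); last 2 first.
  - by lra.
  - by apply: cont_onS cw; lra.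
  set I1 := segint _ _ _; set I2 := segint _ _ _; set I3 := segint _ _ _.
  move=> HC.
  have side x : x0 - l <= x <= x0 + l -> e1 <= `|x - x0| ->
      - (M * expR (N%:R * b)) <= g x * expR (N%:R * cos (k * (x0 - x))).
    move=> xl xe; rewrite cosE.
    have [xe2|xe2] := ltP `|x - x0| e2.
      apply: (@le_trans _ _ 0); first by rewrite oppr_le0 mulr_ge0 ?expR_ge0.
      rewrite mulr_ge0 ?expR_ge0//.
      by apply: le_trans (Hd x (lt_trans xe2 e2d)); lra.
    have xln : `|x - x0| <= l by rewrite ler_norml; lra.
    have h1 : expR (N%:R * cos (k * `|x - x0|)) <= expR (N%:R * b).
      rewrite ler_expR ler_wpM2l ?ler0n//; apply: cos_le.
      - lra.
      - by rewrite ler_pM2l.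
      - by have := kle _ xln; lra.
    apply: (@le_trans _ _ (- (M * expR (N%:R * cos (k * `|x - x0|))))).
      by rewrite lerN2 ler_wpM2l.
    rewrite -mulNr ler_wpM2r ?expR_ge0//.
    by have := HM x xl; rewrite ler_norml => /andP[].
  have h1 : - (M * expR (N%:R * b)) * (l - e1) <= I1.
    have -> : l - e1 = (x0 - e1) - (x0 - l) by ring.
    rewrite -segint_cst; last lra.
    apply: segint_le => //; first by apply: cont_onS cw; lra.
    move=> x xl; apply: side; first lra.
    by rewrite ler0_norm; lra.
  have h3 : - (M * expR (N%:R * b)) * (l - e1) <= I3.
    have -> : l - e1 = (x0 + l) - (x0 + e1) by ring.
    rewrite -segint_cst; last lra.
    apply: segint_le => //; first by apply: cont_onS cw; lra.
    move=> x xl; apply: side; first lra.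
    by rewrite ger0_norm; lra.
  have h2 : g x0 / 2 * expR (N%:R * a) * (e1 + e1) <= I2.
    have -> : e1 + e1 = (x0 + e1) - (x0 - e1) by ring.
    rewrite -segint_cst; last lra.
    apply: segint_le => //; first by apply: cont_onS cw; lra.
    move=> x xl; rewrite cosE.
    have xe : `|x - x0| <= e1 by rewrite ler_norml; lra.
    apply: ler_pM; rewrite ?expR_ge0//; first lra.
      by apply: Hd; apply: (le_lt_trans xe); lra.
    rewrite ler_expR ler_wpM2l ?ler0n//; apply: cos_le.
    - by rewrite mulr_ge0// ltW.
    - by rewrite ler_pM2l.
    - by lra.
  have h4 : c * expR (N%:R * a) - 2 * l * M * expR (N%:R * b) <= C.
    apply: le_trans HC; apply: le_trans (ler_norm _).
    have h5 : 0 <= M * expR (N%:R * b) by rewrite mulr_ge0 ?expR_ge0.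
    have h6 : 0 <= M * expR (N%:R * b) * e1 by rewrite mulr_ge0// ltW.
    apply: le_trans (lerD h1 (lerD h2 h3)); rewrite /c.
    move: h6; clear; lra.
  have C0 : 0 <= C by apply: le_trans (H 0%N).
  have eb : 1 <= expR (N%:R * b).
    by apply: le_trans (expR_ge1Dx _); rewrite lerDl mulr_ge0 ?ler0n.
  have -> : N%:R * (a - b) = N%:R * a - N%:R * b by ring.
  rewrite expRB mulrA ler_pdivrMr ?expR_gt0//.
  rewrite mulrDl; apply: (@le_trans _ _ (C + 2 * l * M * expR (N%:R * b))).
    by move: h4; clear; lra.
  by rewrite lerD2r ler_peMr.
have [N HN] : exists N : nat, (C + 2 * l * M) / (c * (a - b)) < N%:R.
  exists (Num.truncn ((C + 2 * l * M) / (c * (a - b)))).+1.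
  exact: truncnS_gt.
have := Hmain N; apply/negP; rewrite -ltNge.
have cab : 0 < c * (a - b) by rewrite mulr_gt0// subr_gt0.
move: HN; rewrite ltr_pdivrMr// => HN; apply: (lt_le_trans HN).
rewrite mulrCA ler_pM2l//; apply: le_trans (expR_ge1Dx _).
by rewrite lerDr.
Qed.

Lemma peak_zero (x0 l k C : R) (g : R -> R) : 0 < l -> k * l = pi / 2 ->
  cont_on (x0 - l) (x0 + l) g ->
  (forall N : nat, `|segint (x0 - l) (x0 + l)
      (fun x => g x * expR (N%:R * cos (k * (x0 - x))))| <= C) ->
  g x0 = 0.
Proof.
move=> l0 kl cg H; apply/eqP; rewrite eq_le (peak_le0 l0 kl cg H) /=.
rewrite -oppr_le0; apply: (@peak_le0 x0 l k C (fun x => - g x)) => //.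
  by move=> x xl; apply: continuousN; exact: cg.
move=> N; rewrite (@eq_segint R _ _ _ (fun x =>
    - (g x * expR (N%:R * cos (k * (x0 - x)))))); last first.
  by move=> x _; rewrite mulNr.
by rewrite segintN ?normrN//; exact: cont_on_peak.
Qed.

(** The pair of cos (k (z - w)), where w = x0 + i y0. *)
Lemma cr_cos (x0 y0 k : R) p : exists A B,
  cr_pair (fun z => 2^-1 * (expR (k * (z.2 - y0)) * cos (k * (x0 - z.1)) +
               expR (- (k * (z.2 - y0))) * cos (- (k * (x0 - z.1)))))
     (fun z => 2^-1 * (expR (k * (z.2 - y0)) * sin (k * (x0 - z.1)) +
               expR (- (k * (z.2 - y0))) * sin (- (k * (x0 - z.1))))) p A B.
Proof.
have H := cr_affine x0 y0 k p.
by do 2 eexists; apply: crZ; apply: crD; apply: cr_exp; [exact: H|exact: crN H].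
Qed.

Lemma cr_continuous u v p A B : cr_pair u v p A B ->
  {for p, continuous u} /\ {for p, continuous v}.
Proof. by move=> [du dv]; split; apply: differentiable_continuous. Qed.

(** Goursat's theorem is applied to (u + i v) exp (N cos (k (z - w))), where w
    = x0 + i t and k l = pi / 2. The bottom side contributes nothing. On the
    lateral sides cos (k (z - w)) is purely imaginary, so the weight has
    modulus 1 and the contribution is bounded independently of N. On the top
    side the weight is real with its peak at x0, so peak_zero applies. The
    width l may be arbitrarily small compared with the height t, so the
    rectangle fits in any disc that contains the axis. *)
Lemma cr_unique u v (x0 l t : R) : 0 < l -> 0 <= t ->
  (forall p, in_rect (x0 - l) (x0 + l) 0 t p ->
    exists A B, cr_pair u v p A B) ->
  (forall x, x0 - l <= x <= x0 + l -> u (x, 0) = 0 /\ v (x, 0) = 0) ->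
  u (x0, t) = 0.
Proof.
move=> l0 t0 cuv uv0.
have xl : x0 - l <= x0 + l by lra.
have cu p : in_rect (x0 - l) (x0 + l) 0 t p -> {for p, continuous u}.
  by move=> /cuv [A [B /cr_continuous[]]].
have cv p : in_rect (x0 - l) (x0 + l) 0 t p -> {for p, continuous v}.
  by move=> /cuv [A [B /cr_continuous[]]].
pose k := (pi / 2) / l.
have kl : k * l = pi / 2 by rewrite /k divfK// gt_eqF.
(* cc and cs are the parts of cos (k (z - w)), wa and wb those of the weight *)
pose cc (z : R * R) := 2^-1 * (expR (k * (z.2 - t)) * cos (k * (x0 - z.1)) +
               expR (- (k * (z.2 - t))) * cos (- (k * (x0 - z.1)))).
pose cs (z : R * R) := 2^-1 * (expR (k * (z.2 - t)) * sin (k * (x0 - z.1)) +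
               expR (- (k * (z.2 - t))) * sin (- (k * (x0 - z.1)))).
pose wa (N : nat) z := expR (N%:R * cc z) * cos (N%:R * cs z).
pose wb (N : nat) z := expR (N%:R * cc z) * sin (N%:R * cs z).
pose U N z := u z * wa N z - v z * wb N z.
pose V N z := u z * wb N z + v z * wa N z.
have crUV N p : in_rect (x0 - l) (x0 + l) 0 t p ->
    exists A B, cr_pair (U N) (V N) p A B.
  move=> /cuv [A [B H]]; have [A' [B' H']] := cr_cos x0 t k p.
  have := crM H (cr_exp (crZ N%:R H')).
  by set A1 := (X in cr_pair _ _ _ X _);
    set B1 := (X in cr_pair _ _ _ _ X) => H1;
    exists A1, B1.
have circ N : circulation (U N) (fun z => - V N z) (x0 - l) (x0 + l) 0 t = 0.
  apply: goursat => // p /(crUV N) [A [B]]; exact: cr_closed.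
have csl : cont_on 0 t (fun y => `|u (x0 + l, y)| + `|v (x0 + l, y)| +
      (`|u (x0 - l, y)| + `|v (x0 - l, y)|)).
  have cn (F : R * R -> R) x : x0 - l <= x <= x0 + l ->
     (forall p, in_rect (x0 - l) (x0 + l) 0 t p -> {for p, continuous F}) ->
     forall y, 0 <= y <= t -> {for y, continuous (fun y => `|F (x, y)|)}.
    move=> xx cF y yt; apply: (continuous_comp (f := fun y => F (x, y)));
      last exact: norm_continuous.
    by apply: cont_slice2; apply: cF.
  have xr : x0 - l <= x0 + l <= x0 + l by lra.
  have xl' : x0 - l <= x0 - l <= x0 + l by lra.
  by move=> y yt; apply: continuousD; apply: continuousD; apply: cn.
have [M HM] := cont_on_bounded t0 csl.
apply: (@peak_zero x0 l k (M * t) (fun x => u (x, t))) => //.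
  by move=> x xx; apply: cont_slice1; apply: cu; split => /=; lra.
move=> N.
have := circ N; rewrite /circulation.
have -> : segint (x0 - l) (x0 + l) (fun x => U N (x, 0) - U N (x, t)) =
   - segint (x0 - l) (x0 + l)
       (fun x => u (x, t) * expR (N%:R * cos (k * (x0 - x)))).
  rewrite -segintN; last first.
    apply: cont_on_peak => x xx; apply: cont_slice1; apply: cu.
    by split => /=; lra.
  apply: eq_segint => x xx; rewrite /U; have [-> ->] := uv0 x xx.
  rewrite /wb /wa.
  have -> : cc (x, t) = cos (k * (x0 - x)).
    rewrite /cc /= subrr mulr0 oppr0 expR0 !mul1r cosN.
    by clear; lra.
  have -> : cs (x, t) = 0.
    by rewrite /cs /= subrr mulr0 oppr0 expR0 !mul1r sinN subrr mulr0.
  rewrite mulr0 sin0 cos0; ring.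
move=> /eqP; rewrite addrC subr_eq0 => /eqP <-.
have := @segint_near_cst R 0 t
  (fun y => - V N (x0 + l, y) - - V N (x0 - l, y)) 0 M t0.
rewrite mul0r !subr0; apply.
  apply: (@cont_on_side _ (fun z => - V N z)) => // p pin.
  have [A [B /cr_continuous[_ c]]] := crUV N p pin.
  exact: continuousN.
have Vb x y : cos (k * (x0 - x)) = 0 ->
    `|V N (x, y)| <= `|u (x, y)| + `|v (x, y)|.
  move=> c0; have ccE : cc (x, y) = 0.
    by rewrite /cc /= cosN c0 !mulr0 addr0 mulr0.
  rewrite /V /wa /wb ccE mulr0 expR0 !mul1r.
  apply: (le_trans (ler_normD _ _)); rewrite !normrM.
  by apply: lerD; rewrite -[leRHS]mulr1 ler_wpM2l//;
    [exact: sin_max|exact: cos_max].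
move=> y yt.
have h1 := Vb (x0 + l) y; have h2 := Vb (x0 - l) y.
have {}h1 : `|V N (x0 + l, y)| <= `|u (x0 + l, y)| + `|v (x0 + l, y)|.
  by apply: h1; rewrite opprD addrA subrr sub0r mulrN kl cosN cos_pihalf.
have {}h2 : `|V N (x0 - l, y)| <= `|u (x0 - l, y)| + `|v (x0 - l, y)|.
  by apply: h2; rewrite opprB addrCA subrr addr0 kl cos_pihalf.
have := HM y yt; set s := _ + _ => hs.
have : s <= `|s| by exact: ler_norm.
rewrite subr0 opprK /s.
move: (ler_normD (- V N (x0 + l, y)) (V N (x0 - l, y))) hs h1 h2.
rewrite normrN /s; clear; lra.
Qed.

End uniqueness.

(** * Quaternions and their slices *)

Section quaternion_algebra.
Variable R : realType.
Local Notation H := (quat R).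
Implicit Types (p q i j : H).

Lemma quat_normM p q : `|p * q| = `|p| * `|q|.
Proof.
rewrite !quat_normE -sqrtrM -/(quat_sqnorm _) ?quat_sqnorm_ge0//.
by congr Num.sqrt; rewrite /quat_sqnorm /=; ring.
Qed.

Lemma quat_norm_sq q : `|q| ^+ 2 = quat_sqnorm q.
Proof. by rewrite quat_normE sqr_sqrtr// quat_sqnorm_ge0. Qed.

Lemma quat_norm1 : `|1 : H| = 1.
Proof.
by rewrite quat_normE /= expr0n /= expr1n !addr0 sqrtr1.
Qed.

Lemma quat_normV q : `|q^-1| = `|q|^-1.
Proof.
have [->|q0] := eqVneq q 0; first by rewrite invr0 !normr0 invr0.
apply: (mulIf (_ : `|q| != 0)); first by rewrite normr_eq0.
by rewrite -quat_normM mulVr// quat_norm1 mulVf// normr_eq0.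
Qed.

Lemma slice_ptE i x y : slice_pt i x y =
  Quat (x + y * q0 i) (y * q1 i) (y * q2 i) (y * q3 i).
Proof. by apply: quatP => /=; ring. Qed.

Lemma sphereP i : sphereS2 i ->
  q0 i = 0 /\ q1 i ^+ 2 + q2 i ^+ 2 + q3 i ^+ 2 = 1.
Proof.
move=> [i0 ni]; split=> //; have := quat_norm_sq i.
by rewrite ni expr1n /quat_sqnorm i0 expr0n /= add0r => <-.
Qed.

Lemma sphere_sqr i : sphereS2 i -> i * i = - 1.
Proof.
by move=> /sphereP[i0 i1]; apply: quatP; rewrite /= i0; try ring; lra.
Qed.

Lemma sphereN i : sphereS2 i -> sphereS2 (- i).
Proof. by move=> [i0 i1]; split; rewrite ?normrN//= i0 oppr0. Qed.

Lemma slice_ptN i x y : slice_pt (- i) x y = slice_pt i x (- y).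
Proof. by rewrite /slice_pt scalerN scaleNr. Qed.

Lemma slice_ptD i a b c d :
  slice_pt i (a + c) (b + d) = slice_pt i a b + slice_pt i c d.
Proof. by rewrite /slice_pt !scalerDl addrACA. Qed.

Lemma slice_ptB i a b c d :
  slice_pt i (a - c) (b - d) = slice_pt i a b - slice_pt i c d.
Proof. by rewrite /slice_pt !scalerBl opprD addrACA. Qed.

Lemma slice_ptZ i r a b : slice_pt i (r * a) (r * b) = r *: slice_pt i a b.
Proof. by rewrite /slice_pt scalerDr !scalerA. Qed.

Lemma slice_ptM i a b c d : sphereS2 i ->
  slice_pt i a b * slice_pt i c d = slice_pt i (a * c - b * d) (a * d + b * c).
Proof.
move=> /sphereP[i0 i1]; rewrite !slice_ptE; apply: quatP; rewrite /= i0; try ring.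
transitivity (a * c - b * d * (q1 i ^+ 2 + q2 i ^+ 2 + q3 i ^+ 2)); first ring.
by rewrite i1; ring.
Qed.

Lemma slice_pt_sqnorm i x y : sphereS2 i ->
  `|slice_pt i x y| ^+ 2 = x ^+ 2 + y ^+ 2.
Proof.
move=> /sphereP[i0 i1]; rewrite quat_norm_sq slice_ptE /quat_sqnorm /= i0.
transitivity (x ^+ 2 + y ^+ 2 * (q1 i ^+ 2 + q2 i ^+ 2 + q3 i ^+ 2)); first ring.
by rewrite i1 mulr1.
Qed.

Lemma slice_pt_norm i x y : sphereS2 i ->
  `|slice_pt i x y| = Num.sqrt (x ^+ 2 + y ^+ 2).
Proof.
by move=> Si; rewrite -(slice_pt_sqnorm x y Si) sqrtr_sqr normr_id.
Qed.

Lemma slice_pt_ge i x y : sphereS2 i ->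
  `|x| <= `|slice_pt i x y| /\ `|y| <= `|slice_pt i x y|.
Proof.
move=> Si; rewrite slice_pt_norm//; split; rewrite -sqrtr_sqr ler_wsqrtr//.
  by rewrite lerDl sqr_ge0.
by rewrite lerDr sqr_ge0.
Qed.

Lemma slice_pt_inj i x y x' y' : sphereS2 i ->
  slice_pt i x y = slice_pt i x' y' -> x = x' /\ y = y'.
Proof.
move=> Si e.
have : `|slice_pt i (x - x') (y - y')| = 0 by rewrite slice_ptB e subrr normr0.
have [] := slice_pt_ge (x - x') (y - y') Si => h1 h2 e0.
move: h1 h2; rewrite e0 !normr_le0 !subr_eq0 => /eqP -> /eqP ->; by [].
Qed.

Lemma slice_pt_inv i x y : sphereS2 i ->
  (slice_pt i x y)^-1 =
  slice_pt i (x / (x ^+ 2 + y ^+ 2)) (- y / (x ^+ 2 + y ^+ 2)).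
Proof.
move=> Si; have [i0 i1] := sphereP Si.
transitivity (quat_inv (slice_pt i x y)).
  by [].
rewrite /quat_inv -quat_norm_sq slice_pt_sqnorm// !slice_ptE.
by rewrite i0; apply: quatP => /=; ring.
Qed.

(** The representation formula reads
    f (x + j y) = 1/2 (1 - j i) f (x + i y) + 1/2 (1 + j i) f (x - i y);
    its two coefficients are rep_coef j i and rep_coef j (- i), and x - i y is
    the point of parameters (x, y) in the slice of - i. *)
Definition rep_coef j i : H := 2^-1 *: (1 - j * i).

Lemma rep_coefN j i : rep_coef j (- i) = 2^-1 *: (1 + j * i).
Proof. by rewrite /rep_coef mulrN opprK. Qed.

Lemma rep_coef_sum j i : rep_coef j i + rep_coef j (- i) = 1.
Proof.
by rewrite rep_coefN /rep_coef -scalerDr; apply: quatP => /=; field.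
Qed.

(** This is j (1 - j i) = j + i = (1 - j i) i. *)
Lemma rep_coef_slice i j x y : sphereS2 i -> sphereS2 j ->
  slice_pt j x y * rep_coef j i = rep_coef j i * slice_pt i x y.
Proof.
move=> Si Sj; rewrite /rep_coef /slice_pt -scalerAr -scalerAl; congr (_ *: _).
rewrite [LHS]mulrDl [RHS]mulrDr; congr (_ + _).
  by rewrite -scalerAl mul1r -scalerAr mulr1.
rewrite -scalerAl -scalerAr; congr (_ *: _).
rewrite mulrBr mulrBl mulr1 mul1r mulrA (sphere_sqr Sj) -mulrA (sphere_sqr Si).
by rewrite mulN1r mulrN1 !opprK addrC.
Qed.

Lemma rep_coef_norm i j : sphereS2 i -> sphereS2 j -> `|rep_coef j i| <= 1.
Proof.
move=> [_ ni] [_ nj]; rewrite /rep_coef normrZ ger0_norm ?invr_ge0//.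
have : `|1 - j * i| <= 2.
  by apply: (le_trans (ler_normB _ _)); rewrite quat_normM ni nj quat_norm1; lra.
lra.
Qed.

End quaternion_algebra.

(** * Derivatives along a slice *)

Lemma is_diff_lin_bounded (R : realType) (V W : normedModType R)
    (L : V -> W) (k : R) (p : V) :
  linear L -> (forall x, `|L x| <= k * `|x|) -> is_diff p L L.
Proof.
move=> lL bL.
pose L' : {linear V -> W} :=
  HB.pack L (GRing.isLinear.Build R V W *:%R L lL).
have cL : continuous L'.
  apply: bounded_linear_continuous; apply/linear_boundedP.
  exists k; split; first exact: num_real.
  move=> r kr x; apply: (le_trans (bL x)); apply: ler_wpM2r => //; exact: ltW.
by apply: DiffDef; [exact: (linear_differentiable p cL)|rewrite (diff_lin p cL)].
Qed.

Section slice_derivative.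
Variable R : realType.
Local Notation H := (quat R).
Implicit Types (i j : H) (F : R * R -> H) (p : R * R).

(** F, seen as a function on C(i), has derivative D at p.  Functions on a slice
    are written in the real coordinates (x, y), with x + i y acting on the
    left, so that the Cauchy-Riemann equation F_y = i F_x is built in. *)
Definition slice_diff i F p (D : H) :=
  is_diff p F (fun h => slice_pt i h.1 h.2 * D).

Lemma is_diff_lmul (c : H) F dF p : is_diff p F dF ->
  is_diff p (fun z => c * F z) (fun h => c * dF h).
Proof.
move=> dFp; apply: is_diff_comp; apply: (@is_diff_lin_bounded _ _ _ _ `|c|).
  by move=> r x y; rewrite mulrDr -scalerAr.
by move=> x; rewrite quat_normM.
Qed.

Lemma norm_q0_le (q : H) : `|q0 q| <= `|q|.
Proof.
rewrite quat_normE -sqrtr_sqr ler_wsqrtr// -!addrA lerDl.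
by rewrite !addr_ge0 ?sqr_ge0.
Qed.

Lemma is_diff_q0 (F : R * R -> H) dF p : is_diff p F dF ->
  is_diff p (fun z => q0 (F z)) (fun h => q0 (dF h)).
Proof.
move=> dFp; apply: is_diff_comp; apply: (@is_diff_lin_bounded _ _ _ _ 1) => //.
by move=> x; rewrite mul1r norm_q0_le.
Qed.

Lemma is_diff_rmul (c : H) F dF p : is_diff p F dF ->
  is_diff p (fun z => F z * c) (fun h => dF h * c).
Proof.
move=> dFp; have dL : is_diff (F p) (fun x : H => x * c) (fun x => x * c).
  apply: (@is_diff_lin_bounded _ _ _ _ `|c|).
    by move=> r x y; rewrite mulrDl -scalerAl.
  by move=> x; rewrite quat_normM mulrC.
exact: (is_diff_comp dFp dL).
Qed.

Lemma is_diff_slice_pt i p : is_diff p (fun z : R * R => slice_pt i z.1 z.2)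
  (fun h => slice_pt i h.1 h.2).
Proof.
apply: (@is_diff_lin_bounded _ _ _ _ (1 + `|i|)).
  by move=> r x y /=; rewrite -slice_ptZ -slice_ptD.
move=> x; apply: (le_trans (ler_normD _ _)).
rewrite !normrZ quat_norm1 mulr1 mulrDl mul1r [`|i| * _]mulrC.
by apply: lerD; rewrite ?ler_wpM2r// prod_normE le_max lexx ?orbT.
Qed.

Lemma slice_regular_diff (Om : set H) f i x y : slice_regular Om f ->
  sphereS2 i -> Om (slice_pt i x y) ->
  slice_diff i (fun z => f (slice_pt i z.1 z.2)) (x, y)
    (derive1 (fun t => f (slice_pt i t y)) x).
Proof.
move=> [df crf] Si Oq; have dq := df _ Oq.
have dfq : is_diff (slice_pt i x y) f ('d f (slice_pt i x y)).
  exact: differentiableP.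
have Ex : derive1 (fun t => f (slice_pt i t y)) x = 'd f (slice_pt i x y) 1.
  have d1 : is_diff x (fun t => slice_pt i t y) (fun h => h%:A : H).
    have dl : is_diff x (fun t : R => t%:A : H) (fun h => h%:A).
      apply: (@is_diff_lin_bounded _ _ _ _ 1).
        by move=> r a b; rewrite scalerDl scalerA.
      by move=> a; rewrite normrZ quat_norm1 mulr1 mul1r.
    apply: (is_diff_eq (is_diffD dl (is_diff_cst (y *: i) x))).
    by rewrite addr0.
  have d2 := is_diff_comp d1 dfq.
  have -> : (fun t => f (slice_pt i t y)) = f \o (fun t => slice_pt i t y) by [].
  rewrite derive1E'; last exact: ex_diff.
  by rewrite diff_val /= scale1r.
have Ey : derive1 (fun t => f (slice_pt i x t)) y = 'd f (slice_pt i x y) i.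
  have d1 : is_diff y (fun t => slice_pt i x t) (fun h => h *: i).
    have dl : is_diff y (fun t : R => t *: i) (fun h => h *: i).
      apply: (@is_diff_lin_bounded _ _ _ _ `|i|).
        by move=> r a b; rewrite scalerDl scalerA.
      by move=> a; rewrite normrZ mulrC.
    apply: (is_diff_eq (is_diffD (is_diff_cst (x%:A : H) y) dl)).
    by rewrite add0r.
  have d2 := is_diff_comp d1 dfq.
  have -> : (fun t => f (slice_pt i x t)) = f \o (fun t => slice_pt i x t) by [].
  rewrite derive1E'; last exact: ex_diff.
  by rewrite diff_val /= scale1r.
have := crf i Si x y Oq; rewrite Ex Ey => cr0.
have di : 'd f (slice_pt i x y) i = i * 'd f (slice_pt i x y) 1.
  have : i * ('d f (slice_pt i x y) 1 + i * 'd f (slice_pt i x y) i) = 0.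
    by rewrite cr0 mulr0.
  rewrite mulrDr mulrA (sphere_sqr Si) mulN1r => /eqP.
  by rewrite subr_eq0 => /eqP.
apply: (is_diff_eq (is_diff_comp (is_diff_slice_pt i (x, y)) dfq)).
apply/funext => h /=; rewrite linearD !linearZ /= di.
by rewrite /slice_pt mulrDl -!scalerAl mul1r.
Qed.

(** These real pairs, one for each quaternion a, reduce unique continuation for
    quaternion-valued functions to cr_unique. *)
Lemma slice_diff_cr i F p D (a : H) : sphereS2 i -> slice_diff i F p D ->
  cr_pair (fun z => q0 (F z * a)) (fun z => - q0 (i * (F z * a))) p
     (q0 (D * a)) (- q0 (i * (D * a))).
Proof.
move=> Si dF; split.
  apply: (is_diff_eq (is_diff_q0 (is_diff_rmul a dF))).
  apply/funext => h; rewrite /slice_pt mulrDl -!scalerAl mulrDl mul1r -!scalerAl.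
  by rewrite -!mulrA /=; ring.
apply: (is_diff_eq (is_diffN (is_diff_q0 (is_diff_lmul i (is_diff_rmul a dF))))).
apply/funext => h; rewrite !fctE /slice_pt mulrDl -!scalerAl mulrDl mul1r -!scalerAl.
rewrite mulrDr -!scalerAr -!mulrA [i * (i * _)]mulrA (sphere_sqr Si) mulN1r /=.
by ring.
Qed.

(** Taking for a the conjugate of F (x0, t) turns Re (F a) into the squared
    modulus at the point of interest. *)
Lemma slice_unique i F (x0 l t : R) : sphereS2 i -> 0 < l -> 0 <= t ->
  (forall p, in_rect (x0 - l) (x0 + l) 0 t p -> exists D, slice_diff i F p D) ->
  (forall x, x0 - l <= x <= x0 + l -> F (x, 0) = 0) ->
  F (x0, t) = 0.
Proof.
move=> Si l0 t0 dF F0.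
pose a := Quat (q0 (F (x0, t))) (- q1 (F (x0, t))) (- q2 (F (x0, t)))
  (- q3 (F (x0, t))).
have : q0 (F (x0, t) * a) = 0.
  apply: (@cr_unique _ (fun z => q0 (F z * a))
    (fun z => - q0 (i * (F z * a))) x0 l t) => //.
    by move=> p /dF [D /(slice_diff_cr a Si)]; do 2 eexists; eassumption.
  by move=> x /F0 ->; rewrite mul0r mulr0 /= oppr0.
move=> h; apply/eqP; rewrite -quat_sqnorm_eq0 -{}h; apply/eqP.
by rewrite /a /quat_sqnorm /=; ring.
Qed.

(** Applied to the defect of the representation formula, this transfers the
    formula from f to its derivative. *)
Lemma slice_diff0 i F p D : sphereS2 i -> slice_diff i F p D ->
  (\forall z \near p, F z = 0) -> D = 0.
Proof.
move=> Si dF F0; have Fp : F p = 0 := nbhs_singleton F0.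
apply/eqP; rewrite -normr_le0; apply/ler_addgt0Pl => e e0; rewrite addr0.
have [d d0 Hd] := is_diff_near dF e0.
move/nbhs_normP : F0 => [r /= r0 Hr].
pose m := Num.min d r / 2.
have m0 : 0 < m by rewrite /m divr_gt0// lt_min d0.
have [md mr] : m < d /\ m < r.
  have : Num.min d r <= d /\ Num.min d r <= r by rewrite !ge_min !lexx orbT.
  by rewrite /m in m0 *; lra.
pose q := p + (m, 0).
have qp : q - p = (m, 0) by rewrite /q addrC addKr.
have nm : `|(m, 0) : R * R| = m.
  by rewrite prod_normE /= normr0 gtr0_norm// max_l// ltW.
have := Hd q; rewrite qp nm => /(_ md); rewrite Fp Hr; last first.
  by rewrite /= /ball_ /= -opprB qp normrN nm.
rewrite subr0 sub0r normrN /= /slice_pt scale0r addr0 mulr_algl normrZ.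
by rewrite gtr0_norm// mulrC ler_pM2r.
Qed.

End slice_derivative.

(** * The representation formula *)

Section representation.
Variable R : realType.
Local Notation H := (quat R).
Implicit Types (i j : H) (f : H -> H).

Lemma qball_slice i (x y : R) : sphereS2 i ->
  qball (slice_pt i x y) <-> x ^+ 2 + y ^+ 2 < 1.
Proof.
move=> Si; rewrite /qball /= slice_pt_norm// -{1}[1]sqrtr1 ltr_sqrt//.
Qed.

Definition slice_deriv f i (z : R * R) : H :=
  derive1 (fun t => f (slice_pt i t z.2)) z.1.

Definition rep_defect f j i (z : R * R) : H :=
  f (slice_pt j z.1 z.2) - (rep_coef j i * f (slice_pt i z.1 z.2) +
    rep_coef j (- i) * f (slice_pt (- i) z.1 z.2)).

(** By rep_coef_slice both terms of the formula are holomorphic for the left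
    structure of C(j), although f is holomorphic there for that of C(i). *)
Lemma rep_defect_diff f i j (z : R * R) : slice_regular qball f ->
  sphereS2 i -> sphereS2 j -> z.1 ^+ 2 + z.2 ^+ 2 < 1 ->
  slice_diff j (rep_defect f j i) z
    (slice_deriv f j z - (rep_coef j i * slice_deriv f i z +
      rep_coef j (- i) * slice_deriv f (- i) z)).
Proof.
case: z => x y rf Si Sj /= xy1; have Sn := sphereN Si.
have dj := slice_regular_diff rf Sj ((qball_slice _ _ Sj).2 xy1).
have di := slice_regular_diff rf Si ((qball_slice _ _ Si).2 xy1).
have dn := slice_regular_diff rf Sn ((qball_slice _ _ Sn).2 xy1).
apply: (is_diff_eq (is_diffB dj (is_diffD (is_diff_lmul (rep_coef j i) di)
  (is_diff_lmul (rep_coef j (- i)) dn)))).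
apply/funext => h; rewrite !fctE /slice_deriv /=.
rewrite mulrBr mulrDr; congr (_ - (_ + _)).
  by rewrite !mulrA rep_coef_slice.
by rewrite !mulrA rep_coef_slice.
Qed.

(** On the real axis the three values of f coincide and the coefficients sum to
    1, so the defect vanishes there and unique continuation applies. *)
Lemma rep_defect0_upper f i j (x y : R) : slice_regular qball f ->
  sphereS2 i -> sphereS2 j -> x ^+ 2 + y ^+ 2 < 1 -> 0 <= y ->
  rep_defect f j i (x, y) = 0.
Proof.
(* with this width the corners of the rectangle stay inside the disc *)
move=> rf Si Sj xy1 y0; pose l := (1 - (x ^+ 2 + y ^+ 2)) / 4.
have l0 : 0 < l by rewrite /l; lra.
have xx := sqr_ge0 x; have yy := sqr_ge0 y.
have lE : 4 * l = 1 - (x ^+ 2 + y ^+ 2) by rewrite /l; lra.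
have l4 : l <= 1 / 4 by rewrite /l; lra.
clearbody l.
have x1 : `|x| < 1.
  by rewrite -(@ltr_pXn2r _ 2) ?nnegrE// real_normK ?num_real// expr1n; lra.
apply: (@slice_unique _ j _ x l y) => // [[s t]|s sl].
  move=> [/= sl ty]; eexists; apply: rep_defect_diff => //=.
  have st : `|s| <= `|x| + l.
    by have := ler_normD x (s - x); rewrite addrC subrK => h;
      apply: (le_trans h); rewrite lerD2l ler_norml; lra.
  have s2 : s ^+ 2 <= (`|x| + l) ^+ 2.
    by rewrite -[leLHS]real_normK ?num_real// ler_pXn2r ?nnegrE// addr_ge0// ltW.
  have t2 : t ^+ 2 <= y ^+ 2 by rewrite ler_pXn2r ?nnegrE//; lra.
  have xl : (`|x| + l) ^+ 2 <= x ^+ 2 + 2 * l + l / 4.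
    have -> : (`|x| + l) ^+ 2 = `|x| ^+ 2 + 2 * (`|x| * l) + l * l by ring.
    rewrite real_normK ?num_real//.
    have h1 : `|x| * l <= l by rewrite ger_pMl// ltW.
    have h2 : l * l <= l * (1 / 4) by rewrite ler_pM2l.
    lra.
  by move: s2 t2 xl lE l0; clear; lra.
rewrite /rep_defect /= /slice_pt !scale0r !addr0 -mulrDl rep_coef_sum mul1r.
by rewrite subrr.
Qed.

(** For y < 0, the formula for (i, j) at (x, y) is the one for (- i, - j) at
    (x, - y). *)
Lemma rep_defect0 f i j (x y : R) : slice_regular qball f ->
  sphereS2 i -> sphereS2 j -> x ^+ 2 + y ^+ 2 < 1 ->
  rep_defect f j i (x, y) = 0.
Proof.
move=> rf Si Sj xy1; have [y0|y0] := leP 0 y; first exact: rep_defect0_upper.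
have := @rep_defect0_upper f (- i) (- j) x (- y) rf (sphereN Si) (sphereN Sj).
rewrite sqrrN oppr_ge0 => /(_ xy1 (ltW y0)).
rewrite /rep_defect /= !slice_ptN !opprK /rep_coef !mulrNN !mulNr !mulrN.
by rewrite !opprK.
Qed.

Lemma representation_formula f i j (x y : R) : slice_regular qball f ->
  sphereS2 i -> sphereS2 j -> x ^+ 2 + y ^+ 2 < 1 ->
  f (slice_pt j x y) = rep_coef j i * f (slice_pt i x y) +
    rep_coef j (- i) * f (slice_pt (- i) x y).
Proof.
by move=> rf Si Sj xy1; apply/eqP; rewrite -subr_eq0 -(rep_defect0 rf Si Sj xy1).
Qed.

Lemma open_disc : open [set z : R * R | z.1 ^+ 2 + z.2 ^+ 2 < 1].
Proof.
have -> : [set z : R * R | z.1 ^+ 2 + z.2 ^+ 2 < 1] =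
   (fun z : R * R => z.1 ^+ 2 + z.2 ^+ 2) @^-1` [set r | r < 1] by [].
apply: open_comp; last exact: open_lt.
move=> z _; apply: (@continuousD _ _ _ (fun z : R * R => z.1 ^+ 2)
    (fun z : R * R => z.2 ^+ 2)).
  apply: (@continuous_comp _ _ _ fst (fun r : R => r ^+ 2)).
    exact: cvg_fst.
  exact: exprn_continuous.
apply: (@continuous_comp _ _ _ snd (fun r : R => r ^+ 2)).
  exact: cvg_snd.
exact: exprn_continuous.
Qed.

Lemma representation_formula_deriv f i j (x y : R) : slice_regular qball f ->
  sphereS2 i -> sphereS2 j -> x ^+ 2 + y ^+ 2 < 1 ->
  slice_deriv f j (x, y) = rep_coef j i * slice_deriv f i (x, y) +
    rep_coef j (- i) * slice_deriv f (- i) (x, y).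
Proof.
move=> rf Si Sj xy1; apply/eqP; rewrite -subr_eq0; apply/eqP.
apply: (slice_diff0 Sj (rep_defect_diff rf Si Sj (z := (x, y)) xy1)).
have : nbhs ((x, y) : R * R) [set z : R * R | z.1 ^+ 2 + z.2 ^+ 2 < 1].
  by apply: open_nbhs_nbhs; split => //; exact: open_disc.
by apply: filterS => -[a b] /= ab1; exact: rep_defect0.
Qed.

End representation.

(** * Polar coordinates and powers on the slit plane *)

Section logarithm.
Variable R : realType.
Local Notation H := (quat R).
Implicit Types (z : R * R).

Definition slit_plane : set (R * R) := [set z | z.2 = 0 -> 0 < z.1].

Definition lnmod z : R := ln (z.1 ^+ 2 + z.2 ^+ 2) / 2.
Definition rmod z : R := expR (lnmod z).
(** The argument in the interval ]-pi, pi[.  The half-angle formula is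
    differentiable on the whole slit plane, unlike the expressions by acos or
    atan (y / x), each of which breaks down on some line. *)
Definition theta z : R := 2 * atan (z.2 / (rmod z + z.1)).

Lemma slit_plane_gt0 z : slit_plane z -> 0 < z.1 ^+ 2 + z.2 ^+ 2.
Proof.
move=> sz; have [e|e] := eqVneq z.2 0.
  by rewrite e expr0n addr0 exprn_gt0// sz.
by rewrite ltr_wpDl ?sqr_ge0// exprn_even_gt0.
Qed.

Lemma rmod_gt0 z : 0 < rmod z.
Proof. exact: expR_gt0. Qed.

Lemma rmod_sqr z : slit_plane z -> rmod z ^+ 2 = z.1 ^+ 2 + z.2 ^+ 2.
Proof.
move=> /slit_plane_gt0 m0; rewrite /rmod -expRM_natl /lnmod.
by rewrite mulrC divfK// lnK.
Qed.

Lemma rmodD_gt0 z : slit_plane z -> 0 < rmod z + z.1.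
Proof.
move=> sz; have r0 := rmod_gt0 z; have [x0|x0] := ltP 0 z.1; first lra.
have y0 : z.2 != 0.
  by apply/eqP => /sz; rewrite ltNge x0.
have : `|z.1| < rmod z.
  rewrite -(@ltr_pXn2r _ 2) ?nnegrE ?(ltW r0)// rmod_sqr// real_normK ?num_real//.
  by rewrite ltrDl exprn_even_gt0.
by rewrite ltr_norml => /andP[]; lra.
Qed.

Lemma theta_pi z : - pi < theta z < pi.
Proof.
by have := atan_gtNpi2 (z.2 / (rmod z + z.1));
  have := atan_ltpi2 (z.2 / (rmod z + z.1)); rewrite /theta; lra.
Qed.

(** Half-angle formulas: t = y / (r + x) is the tangent of half the argument and
    r cos^2 = (r + x) / 2. *)
Lemma polar_coord z : slit_plane z ->
  z.1 = rmod z * cos (theta z) /\ z.2 = rmod z * sin (theta z).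
Proof.
move=> sz; have d0 := rmodD_gt0 sz; have r0 := rmod_gt0 z.
have rr := rmod_sqr sz; rewrite /theta.
set t := z.2 / (rmod z + z.1); set c := cos (atan t); set s := sin (atan t).
have st : s = t * c.
  have : tan (atan t) = t by exact: atanK.
  rewrite /tan -/s -/c => <-; rewrite divfK//.
  by rewrite gt_eqF// cos_gt0_pihalf// atan_gtNpi2 atan_ltpi2.
have cs1 : c ^+ 2 + s ^+ 2 = 1 by exact: cos2Dsin2.
have c2 : c ^+ 2 * (2 * rmod z) = rmod z + z.1.
  have : c ^+ 2 * ((rmod z + z.1) ^+ 2 + z.2 ^+ 2) = (rmod z + z.1) ^+ 2.
    have -> : z.2 = t * (rmod z + z.1) by rewrite /t divfK// gt_eqF.
    by rewrite -[RHS]mul1r -cs1 st; ring.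
  have -> : (rmod z + z.1) ^+ 2 + z.2 ^+ 2 = 2 * rmod z * (rmod z + z.1).
    have -> : z.2 ^+ 2 = rmod z ^+ 2 - z.1 ^+ 2 by rewrite rr; ring.
    ring.
  rewrite mulrA [_ ^+ 2 in RHS]expr2 => h.
  by apply: (mulIf (negbT (gt_eqF d0))); rewrite -h; ring.
rewrite mulr_natl cos_mulr2n sin_mulr2n -/c -/s; split.
  by rewrite mulrBr mulr1 -mulr_natl; move: c2; clear; lra.
rewrite st -mulr_natl.
transitivity (t * (c ^+ 2 * (2 * rmod z))); last ring.
by rewrite c2 /t divfK// gt_eqF.
Qed.

Lemma slice_pt_polar (i : H) z : slit_plane z -> slice_pt i z.1 z.2 =
  rmod z *: slice_pt i (cos (theta z)) (sin (theta z)).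
Proof. by move=> /polar_coord[{1}-> {1}->]; rewrite slice_ptZ. Qed.

(** pow_re and pow_im are the components of exp (a log z), the same in every
    slice. *)
Definition pow_re (a : R) z := expR (a * lnmod z) * cos (a * theta z).
Definition pow_im (a : R) z := expR (a * lnmod z) * sin (a * theta z).

Lemma qpow_slice (i : H) (a : R) z : sphereS2 i -> slit_plane z ->
  qpow (slice_pt i z.1 z.2) a = slice_pt i (pow_re a z) (pow_im a z).
Proof.
move=> Si sz; rewrite slice_pt_polar// qpow_polar ?rmod_gt0 ?theta_pi//.
by rewrite /rmod -expRM -slice_ptZ [lnmod z * a]mulrC.
Qed.

Lemma is_diff_inv (g : R * R -> R) dg p : is_diff p g dg -> g p != 0 ->
  is_diff p (fun z => (g z)^-1) (fun h => - (g p) ^- 2 * dg h).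
Proof.
move=> dgp gp; apply: DiffDef; first exact: differentiableV.
by rewrite diffV// diff_val.
Qed.

(** The derivative of log z is 1 / z. *)
Lemma cr_log z : slit_plane z -> cr_pair lnmod theta z
  (z.1 / (z.1 ^+ 2 + z.2 ^+ 2)) (- z.2 / (z.1 ^+ 2 + z.2 ^+ 2)).
Proof.
move=> sz; have m0 := slit_plane_gt0 sz; have d0 := rmodD_gt0 sz.
have r0 := rmod_gt0 z; have rr := rmod_sqr sz.
have d1 := is_diff_fst z; have d2 := is_diff_snd z.
have dm : is_diff z (fun z => z.1 ^+ 2 + z.2 ^+ 2)
    (fun h => 2 * (z.1 * h.1 + z.2 * h.2)).
  apply: (is_diff_eq (is_diffD (is_diffM d1 d1) (is_diffM d2 d2))).
  by apply/funext => h; rewrite !fctE /= /GRing.scale /=; ring.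
have dl : is_diff z lnmod
    (fun h => (z.1 * h.1 + z.2 * h.2) / (z.1 ^+ 2 + z.2 ^+ 2)).
  have := is_diff_comp_derive dm (is_derive1_ln m0).
  move=> /(is_diffZ 2^-1) => dl.
  have -> : lnmod = 2^-1 *: (fun z => ln (z.1 ^+ 2 + z.2 ^+ 2)).
    by apply/funext => w; rewrite /lnmod !fctE /= /GRing.scale /= mulrC.
  apply: (is_diff_eq dl); apply/funext => h; rewrite !fctE /= /GRing.scale /=.
  by field; rewrite gt_eqF.
split.
  by apply: (is_diff_eq dl); apply/funext => h; ring.
have dr := is_diff_comp_derive dl (is_derive_expR (lnmod z)).
have drx := is_diffD dr d1.
have dri := is_diff_inv drx (negbT (gt_eqF d0)).
have ds := is_diffM d2 dri.
have dth := is_diffZ 2 (is_diff_comp_derive ds (is_derive1_atan _)).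
apply: (is_diff_eq dth); apply/funext => h; rewrite !fctE /= /GRing.scale /=.
rewrite -/(rmod z) -rr.
(* the differential of theta simplifies once y^2 is written (r - x) (r + x) *)
have y2 : z.2 ^+ 2 = rmod z ^+ 2 - z.1 ^+ 2 by rewrite rr; ring.
move: (rmod z) (z.1) (z.2) h.1 h.2 r0 d0 y2; clear => r x y a b r0 d0 y2.
have E : (1 + (y / (r + x)) ^+ 2)^-1 = (r + x) / (2 * r).
  rewrite exprMn y2 -[RHS]invrK invf_div; congr (_^-1).
  by field; rewrite !gt_eqF.
rewrite E.
transitivity
  ((b * (r + x) * r - y * a * (r + x) - y ^+ 2 * b) / (r ^+ 2 * (r + x))).
  by field; rewrite !gt_eqF.
rewrite y2; by field; rewrite !gt_eqF.
Qed.

Lemma cr_pow (a : R) z : slit_plane z -> exists A B,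
  cr_pair (pow_re a) (pow_im a) z A B /\ forall i : H, sphereS2 i ->
  slice_pt i A B = (a *: (slice_pt i z.1 z.2)^-1) *
    slice_pt i (pow_re a z) (pow_im a z).
Proof.
move=> sz; have := cr_exp (crZ a (cr_log sz)).
set A := (X in cr_pair _ _ _ X _); set B := (X in cr_pair _ _ _ _ X) => dAB.
exists A, B; split=> // i Si.
by rewrite slice_pt_inv// -slice_ptZ slice_ptM.
Qed.

End logarithm.

(** * The chain rule for truncated exponentials *)

Section chain_rule.
Variable R : realType.
Local Notation H := (quat R).
Implicit Types (i j : H) (F G : R * R -> H) (p z : R * R).

(** F takes its values in C(i) and has derivative D at p.  For such functions
    products commute and the product rule holds as in the complex case. *)
Definition slice_hol i F p (D : H) := exists u v A B,
  [/\ cr_pair u v p A B, forall z, F z = slice_pt i (u z) (v z) &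
      D = slice_pt i A B].

Lemma slice_hol_diff i F p D : sphereS2 i -> slice_hol i F p D ->
  slice_diff i F p D.
Proof.
move=> Si [u [v [A [B [[du dv] FE ->]]]]].
have -> : F = (fun z => slice_pt i z.1 z.2) \o (fun z => (u z, v z)).
  by apply/funext => z /=; rewrite FE.
apply: (is_diff_eq (is_diff_comp (is_diff_pair du dv) (is_diff_slice_pt i _))).
apply/funext => h /=; rewrite slice_ptM//; congr slice_pt; ring.
Qed.

Lemma slice_hol_cst i a b p : slice_hol i (fun=> slice_pt i a b) p 0.
Proof.
exists (cst a), (cst b), 0, 0; split=> //; last first.
  by rewrite /slice_pt !scale0r addr0.
split.
  apply: (is_diff_eq (is_diff_cst a p)); apply/funext => h /=.
  by rewrite !mul0r subr0.
apply: (is_diff_eq (is_diff_cst b p)); apply/funext => h /=.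
by rewrite !mul0r addr0.
Qed.

Lemma slice_holM i F G p D E : sphereS2 i ->
  slice_hol i F p D -> slice_hol i G p E ->
  slice_hol i (fun z => F z * G z) p (D * G p + F p * E).
Proof.
move=> Si [u [v [A [B [duv FE ->]]]]] [a [b [A' [B' [dab GE ->]]]]].
have := crM duv dab.
set D1 := (X in cr_pair _ _ _ X _); set D2 := (X in cr_pair _ _ _ _ X) => H1.
exists (fun z => u z * a z - v z * b z), (fun z => u z * b z + v z * a z).
exists D1, D2.
split=> // [z|]; first by rewrite FE GE slice_ptM.
by rewrite FE GE !slice_ptM// -slice_ptD.
Qed.

Lemma slice_holD i F G p D E :
  slice_hol i F p D -> slice_hol i G p E ->
  slice_hol i (fun z => F z + G z) p (D + E).
Proof.
move=> [u [v [A [B [duv FE ->]]]]] [a [b [A' [B' [dab GE ->]]]]].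
exists (fun z => u z + a z), (fun z => v z + b z), (A + A'), (B + B').
by split=> [|z|]; [exact: crD|rewrite FE GE slice_ptD|rewrite slice_ptD].
Qed.

Lemma slice_holZ i F p D (r : R) :
  slice_hol i F p D -> slice_hol i (fun z => r *: F z) p (r *: D).
Proof.
move=> [u [v [A [B [duv FE ->]]]]].
exists (fun z => r * u z), (fun z => r * v z), (r * A), (r * B).
by split=> [|z|]; [exact: crZ|rewrite FE slice_ptZ|rewrite slice_ptZ].
Qed.

Lemma slice_comm i a b c d : sphereS2 i ->
  GRing.comm (slice_pt i a b) (slice_pt i c d).
Proof. by move=> Si; rewrite /GRing.comm !slice_ptM//; congr slice_pt; ring. Qed.

Lemma slice_hol_comm i F p D : sphereS2 i -> slice_hol i F p D ->
  GRing.comm (F p) D.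
Proof. by move=> Si [u [v [A [B [_ -> ->]]]]]; exact: slice_comm. Qed.

Lemma slice_holX i F p D n : sphereS2 i -> slice_hol i F p D ->
  slice_hol i (fun z => F z ^+ n) p (n%:R * F p ^+ n.-1 * D).
Proof.
move=> Si dF; have cF := slice_hol_comm Si dF; elim: n => [|n IH].
  rewrite !mul0r; have := slice_hol_cst i 1 0 p.
  congr slice_hol; apply/funext => z.
  by rewrite expr0 /slice_pt scale1r scale0r addr0.
have := slice_holM Si dF IH; congr slice_hol.
  by apply/funext => z; rewrite exprS.
rewrite /= -natr1 mulrDl mul1r mulrDl [RHS]addrC.
congr (_ + _); first exact: (commrX n (commr_sym cF)).
case: n IH => [|n] _; first by rewrite !mul0r mulr0.
by rewrite /= [in RHS]exprS !mulrA (commr_nat (F p) n.+1).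
Qed.

Lemma exp_trunc0 (q : H) : exp_trunc 0 q = 1.
Proof. by rewrite /exp_trunc big_ord1 expr0 fact0 invr1 scale1r. Qed.

Lemma exp_truncS k (q : H) :
  exp_trunc k.+1 q = exp_trunc k q + (k.+1)`!%:R^-1 *: q ^+ k.+1.
Proof. by rewrite /exp_trunc big_ord_recr. Qed.

(** The derivative of e_k is e_(k-1). *)
Lemma slice_hol_exp_trunc i F p D k : sphereS2 i -> slice_hol i F p D ->
  (0 < k)%N ->
  slice_hol i (fun z => exp_trunc k (F z)) p (exp_trunc k.-1 (F p) * D).
Proof.
move=> Si dF; case: k => // k _ /=; elim: k => [|k IH].
  have := slice_holD (slice_hol_cst i 1 0 p) dF; congr slice_hol.
    apply/funext => z; rewrite exp_truncS exp_trunc0 expr1 invr1 scale1r.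
    by rewrite /slice_pt scale1r scale0r addr0.
  by rewrite add0r exp_trunc0 mul1r.
have := slice_holD IH (slice_holZ (k.+2)`!%:R^-1 (slice_holX k.+2 Si dF)).
congr slice_hol; first by apply/funext => z; rewrite [in RHS]exp_truncS.
rewrite exp_truncS [RHS]mulrDl; congr (_ + _).
rewrite /= -mulrA mulr_natl -[_ *+ k.+2](@scaler_nat R) scalerA -scalerAl.
congr (_ *: _).
by rewrite factS natrM invfM mulrAC mulVf ?mul1r// pnatr_eq0.
Qed.

End chain_rule.

(** * Limits of difference quotients in a slice *)

Section quaternion_limits.
Variable R : realType.
Local Notation H := (quat R).

Lemma quat_cvgM (T : Type) (F : set_system T) (FF : Filter F) (f g : T -> H)
    (a b : H) : f @ F --> a -> g @ F --> b -> (fun t => f t * g t) @ F --> a * b.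
Proof.
move=> fa gb; apply/subr_cvg0/norm_cvg0P.
have fa0 : `|f t - a| @[t --> F] --> (0 : R^o) by apply/norm_cvg0P/subr_cvg0.
have gb0 : `|g t - b| @[t --> F] --> (0 : R^o) by apply/norm_cvg0P/subr_cvg0.
have gn : `|g t| @[t --> F] --> `|b| by exact: cvg_norm.
apply: (@squeeze_cvgr _ _ _ _ (fun=> 0)
  (fun t => `|f t - a| * `|g t| + `|a| * `|g t - b|)).
- apply: nearW => t; rewrite normr_ge0 /=.
  have -> : f t * g t - a * b = (f t - a) * g t + a * (g t - b).
    by rewrite mulrBl mulrBr addrA subrK.
  by apply: (le_trans (ler_normD _ _)); rewrite !quat_normM.
- exact: cvg_cst.
- have -> : (0 : R) = 0 * `|b| + `|a| * 0 by rewrite mul0r mulr0 addr0.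
  by apply: cvgD; apply: cvgM => //; exact: cvg_cst.
Qed.

Lemma quat_cvgV (T : Type) (F : set_system T) (FF : Filter F) (f : T -> H)
    (a : H) : a != 0 -> f @ F --> a -> (fun t => (f t)^-1) @ F --> a^-1.
Proof.
move=> a0 fa; apply/subr_cvg0/norm_cvg0P.
have na : 0 < `|a| by rewrite normr_gt0.
have fa0 : `|f t - a| @[t --> F] --> (0 : R^o) by apply/norm_cvg0P/subr_cvg0.
have fn : `|f t| @[t --> F] --> `|a| by exact: cvg_norm.
apply: (@squeeze_cvgr _ _ _ _ (fun=> 0)
  (fun t => `|f t - a| * (`|f t|^-1 * `|a|^-1))).
- have : \forall t \near F, `|a| / 2 < `|f t|.
    by apply: (cvgr_gt _ fn); rewrite ltr_pdivrMr// ltr_pMr// ltr1n.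
  apply: filterS => t ft; rewrite normr_ge0 /=.
  have ft0 : f t != 0.
    by rewrite -normr_gt0; apply: lt_trans ft; rewrite divr_gt0.
  have -> : (f t)^-1 - a^-1 = (f t)^-1 * (a - f t) * a^-1.
    by rewrite mulrBr mulVr// mulrBl mul1r -mulrA mulrV// mulr1.
  by rewrite !quat_normM !quat_normV distrC mulrCA mulrA.
- exact: cvg_cst.
- have -> : (0 : R) = 0 * (`|a|^-1 * `|a|^-1) by rewrite mul0r.
  apply: cvgM => //; apply: cvgM; last exact: cvg_cst.
  by apply: cvgV => //; rewrite gt_eqF.
Qed.

End quaternion_limits.

Section slice_limits.
Variable R : realType.
Local Notation H := (quat R).
Implicit Types (i j : H) (z : R * R).

Definition slit_disc : set (R * R) :=
  [set z | z.1 ^+ 2 + z.2 ^+ 2 < 1 /\ slit_plane z].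

Lemma slit_qball_pt i z : sphereS2 i ->
  slit_qball (slice_pt i z.1 z.2) <-> slit_disc z.
Proof.
case: z => x y Si; split=> -[/(qball_slice _ _ Si) xy1] /=.
  move=> h; split=> // /= y0; rewrite ltNge; apply/negP => /= x0; apply: h.
  rewrite /= in xy1 y0.
  exists x; rewrite x0 andbT y0 /slice_pt scale0r addr0; split=> //.
  have : `|x| < 1.
    by rewrite -(@ltr_pXn2r _ 2) ?nnegrE// real_normK ?num_real// expr1n;
      move: xy1; rewrite /= y0 expr0n addr0.
  by rewrite ltr_norml => /andP[].
move=> sz; split; first exact: xy1.
move=> [t [/andP[_ t0] e]].
have : slice_pt i x y = slice_pt i t 0 by rewrite e /slice_pt scale0r addr0.
move=> /(slice_pt_inj Si) [xt y0]; have := sz y0; rewrite /= xt.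
by rewrite ltNge t0.
Qed.

Lemma slit_slice_pt i z : sphereS2 i ->
  slit_slice i (slice_pt i z.1 z.2) <-> slit_disc z.
Proof.
move=> Si; split=> [[/(slit_qball_pt _ Si)//]|zD].
by split; [exact/(slit_qball_pt _ Si)|exists z.1, z.2].
Qed.

Lemma slit_sliceP i w : sphereS2 i -> slit_slice i w ->
  exists2 z, slit_disc z & w = slice_pt i z.1 z.2.
Proof.
move=> Si [wb [x [y wE]]]; exists (x, y) => //.
by apply/(slit_qball_pt _ Si); rewrite /= -wE.
Qed.

Lemma slice_filter_proper i z : sphereS2 i -> slit_disc z ->
  ProperFilter (within (slit_slice i) ((slice_pt i z.1 z.2)^')).
Proof.
move=> Si [z1 sz]; split; last exact: within_filter.
move=> /nbhs_normP [r /= r0 Hr].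
have : nbhs (z : R * R) [set z : R * R | z.1 ^+ 2 + z.2 ^+ 2 < 1].
  by apply: open_nbhs_nbhs; split => //; exact: open_disc.
move=> /nbhs_normP [d /= d0 Hd].
pose m := Num.min d r / 2.
have m0 : 0 < m by rewrite /m divr_gt0// lt_min d0.
have [md mr] : m < d /\ m < r.
  have : Num.min d r <= d /\ Num.min d r <= r by rewrite !ge_min !lexx orbT.
  by rewrite /m in m0 *; lra.
have E : slice_pt i (z.1 + m) z.2 - slice_pt i z.1 z.2 = m%:A.
  by rewrite -slice_ptB addrAC subrr add0r subrr /slice_pt scale0r addr0.
apply: (Hr (slice_pt i (z.1 + m) z.2)).
- by rewrite /ball_ /= -opprB E normrN normrZ quat_norm1 mulr1 gtr0_norm.
- rewrite -subr_eq0 E -normr_eq0 normrZ quat_norm1 mulr1 normr_eq0.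
  by rewrite gt_eqF.
- apply/(slit_slice_pt (z.1 + m, z.2) Si); split.
    apply: Hd; rewrite /ball_ /= prod_normE /= subrr normr0.
    by rewrite opprD addrA subrr sub0r normrN gtr0_norm// max_l// ltW.
  by move=> /= /sz; lra.
Qed.

(** The remainder of the differential is multiplied by (z - w)^-1, and the
    distance of two points of a slice bounds that of their coordinates.  The
    function g on quaternions and its expression F in coordinates agree on the
    slit disc, which is where the limit is taken. *)
Lemma slice_quotient_cvg i (g : H -> H) F z D : sphereS2 i -> slit_disc z ->
  (forall z, slit_disc z -> g (slice_pt i z.1 z.2) = F z) ->
  slice_diff i F z D ->
  (slice_pt i z.1 z.2 - w)^-1 * (g (slice_pt i z.1 z.2) - g w)
    @[w --> within (slit_slice i) ((slice_pt i z.1 z.2)^')] --> D.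
Proof.
move=> Si zD gF dF; apply/cvgrPdist_le => e e0.
have [d d0 Hd] := is_diff_near dF e0.
suff : nbhs (slice_pt i z.1 z.2) [set w | w != slice_pt i z.1 z.2 ->
    slit_slice i w -> `|D - (slice_pt i z.1 z.2 - w)^-1 *
      (g (slice_pt i z.1 z.2) - g w)| <= e] by [].
apply/(@nbhs_normP R (quat R)); exists d => //= w /= wd wz ws.
have [q qD wE] := slit_sliceP Si ws.
have Eqz : slice_pt i (q - z).1 (q - z).2 = w - slice_pt i z.1 z.2.
  by rewrite wE -slice_ptB.
have nqz : `|q - z| <= `|w - slice_pt i z.1 z.2|.
  rewrite -Eqz prod_normE ge_max.
  by have [-> ->] := slice_pt_ge (q - z).1 (q - z).2 Si.
have := Hd q; rewrite Eqz wE -!gF// -wE.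
have wd' : `|w - slice_pt i z.1 z.2| < d by rewrite distrC.
move=> /(_ (le_lt_trans nqz wd')) h.
have n0 : 0 < `|w - slice_pt i z.1 z.2| by rewrite normr_gt0 subr_eq0.
have u0 : slice_pt i z.1 z.2 - w != 0 by rewrite subr_eq0 eq_sym.
have -> : D - (slice_pt i z.1 z.2 - w)^-1 * (g (slice_pt i z.1 z.2) - g w) =
  (slice_pt i z.1 z.2 - w)^-1 *
   (g w - g (slice_pt i z.1 z.2) - (w - slice_pt i z.1 z.2) * D).
  rewrite -[w - _]opprB mulNr opprK addrC -[g w - g _]opprB.
  by rewrite [RHS]mulrDr mulrN mulrA mulVr// mul1r.
rewrite quat_normM quat_normV distrC ler_pdivrMl//.
rewrite mulrC; apply: (le_trans h); by rewrite ler_pM2l.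
Qed.

(** The factors (z - w)^-1 cancel. Where h w = h z the quotient of increments
    is 0 by the convention 0^-1 = 0, and so is the product of the quotients. *)
Lemma slice_quotient_div i (g h : H -> H) (z D E : H) :
  E != 0 ->
  (z - w)^-1 * (g z - g w) @[w --> within (slit_slice i) (z^')] --> D ->
  (z - w)^-1 * (h z - h w) @[w --> within (slit_slice i) (z^')] --> E ->
  (h z - h w)^-1 * (g z - g w) @[w --> within (slit_slice i) (z^')]
    --> E^-1 * D.
Proof.
move=> E0 cg ch.
have := quat_cvgM _ (quat_cvgV _ E0 ch) cg.
move=> /(_ _ _); apply: cvg_trans; apply: near_eq_cvg.
suff : nbhs z [set w | w != z -> slit_slice i w ->
    ((z - w)^-1 * (h z - h w))^-1 * ((z - w)^-1 * (g z - g w)) =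
    (h z - h w)^-1 * (g z - g w)] by [].
apply/(@nbhs_normP R (quat R)); exists 1 => //= w _ wz _.
have u : z - w != 0 by rewrite subr_eq0 eq_sym.
have [->|v] := eqVneq (h z - h w) 0; first by rewrite mulr0 invr0 !mul0r.
rewrite invrM ?unitrV// invrK -!mulrA; congr (_ * _).
by rewrite mulrA mulrV// mul1r.
Qed.

End slice_limits.

(** * The operator defining the norm *)

Section fractional_derivative.
Variable R : realType.
Local Notation H := (quat R).
Implicit Types (i j : H) (z : R * R).

Definition slice_pow i (a : R) z := slice_pt i (pow_re a z) (pow_im a z).

(** The derivative e_(k-1) (z^a) a z^(a - 1) of e_k (z^a) in the slice of i, the
    power z^(a - 1) being written z^-1 z^a. *)
Definition exp_pow_deriv i (a : R) k z : H :=
  exp_trunc k.-1 (slice_pow i a z) *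
    ((a *: (slice_pt i z.1 z.2)^-1) * slice_pow i a z).

Lemma slice_pt_neq0 i z : sphereS2 i -> slit_plane z -> slice_pt i z.1 z.2 != 0.
Proof.
move=> Si sz; rewrite -normr_eq0 slice_pt_norm// gt_eqF// sqrtr_gt0.
exact: slit_plane_gt0.
Qed.

Lemma slice_pow_neq0 i a z : sphereS2 i -> slice_pow i a z != 0.
Proof.
move=> Si; rewrite -normr_eq0 slice_pt_norm// gt_eqF// sqrtr_gt0.
rewrite /pow_re /pow_im !exprMn -mulrDr cos2Dsin2 mulr1.
by rewrite exprn_gt0// expR_gt0.
Qed.

Lemma exp_pow_deriv_neq0 i a k z : sphereS2 i -> 0 < a -> slit_disc z ->
  (forall q, slit_qball q -> exp_trunc k.-1 (qpow q a) <> 0) ->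
  exp_pow_deriv i a k z != 0.
Proof.
move=> Si a0 zD ek; have [_ sz] := zD.
have := ek _ ((slit_qball_pt z Si).2 zD); rewrite qpow_slice// => /eqP e0.
have u1 : slice_pt i z.1 z.2 != 0 by exact: slice_pt_neq0.
rewrite -normr_eq0 !quat_normM normrZ quat_normV !mulf_neq0 ?invr_eq0 ?normr_eq0//.
  by rewrite gt_eqF.
exact: slice_pow_neq0.
Qed.

Lemma exp_pow_slice_diff i a k z : sphereS2 i -> (0 < k)%N -> slit_plane z ->
  slice_diff i (fun z => exp_trunc k (slice_pow i a z)) z
    (exp_pow_deriv i a k z).
Proof.
move=> Si k0 sz; apply: slice_hol_diff => //.
apply: (@slice_hol_exp_trunc R i (slice_pow i a)) => //.
have [A [B [dAB /(_ _ Si) DE]]] := cr_pow a sz.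
exists (pow_re a), (pow_im a), A, B; split=> //.
Qed.

(** The limit in the definition of the operator exists, and equals the quotient
    of the derivatives of f and of e_k (z^a) along the slice; the latter does
    not vanish because e_(k-1) (q^a) does not. *)
Lemma dsigmaE (a s : R) k i f z : 0 < a -> (0 < k)%N ->
  (forall q, slit_qball q -> exp_trunc k.-1 (qpow q a) <> 0) ->
  sphereS2 i -> slice_regular qball f -> slit_disc z ->
  dsigma a s k i f (slice_pt i z.1 z.2) =
  (1 - s) *: f (slice_pt i z.1 z.2) +
    s *: ((exp_pow_deriv i a k z)^-1 * slice_deriv f i z).
Proof.
move=> a0 k0 ek Si rf zD; have [z1 sz] := zD.
rewrite /dsigma; congr (_ + _ *: _).
have FF := slice_filter_proper Si zD.
apply: (@cvg_lim H) => //.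
apply: (@slice_quotient_div _ i f (fun w => exp_trunc k (qpow w a))).
- exact: exp_pow_deriv_neq0.
- apply: (slice_quotient_cvg (F := fun z => f (slice_pt i z.1 z.2))) => //.
  have := slice_regular_diff rf Si ((qball_slice z.1 z.2 Si).2 z1).
  by case: z {z1 sz zD FF}.
- apply: (slice_quotient_cvg (g := fun w => exp_trunc k (qpow w a))
    (F := fun z => exp_trunc k (slice_pow i a z))) => //.
    by move=> w [_ sw]; rewrite qpow_slice.
  exact: exp_pow_slice_diff.
Qed.

(** Moving c across exchanges p for q.  This is how a coefficient of the
    representation formula passes from the structure of C(j) to that of C(i). *)
Definition intertwines (c p q : H) := p * c = c * q.

Lemma intertwinesM c p q p' q' : intertwines c p q -> intertwines c p' q' ->
  intertwines c (p * p') (q * q').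
Proof. by rewrite /intertwines => h h'; rewrite -mulrA h' mulrA h mulrA. Qed.

Lemma intertwinesV c p q : p != 0 -> q != 0 ->
  intertwines c p q -> intertwines c p^-1 q^-1.
Proof.
rewrite /intertwines => p0 q0 h; apply: (mulIr (_ : q \is a GRing.unit)) => //.
rewrite -[RHS]mulrA mulVr// mulr1 -mulrA -h mulrA mulVr//; exact: mul1r.
Qed.

Lemma intertwinesZ c p q (r : R) :
  intertwines c p q -> intertwines c (r *: p) (r *: q).
Proof. by rewrite /intertwines -scalerAl -scalerAr => ->. Qed.

Lemma intertwinesX c p q n :
  intertwines c p q -> intertwines c (p ^+ n) (q ^+ n).
Proof.
move=> h; elim: n => [|n IH]; first by rewrite /intertwines !expr0 mul1r mulr1.
by rewrite !exprS; exact: intertwinesM.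
Qed.

Lemma intertwines_exp_trunc c p q k : intertwines c p q ->
  intertwines c (exp_trunc k p) (exp_trunc k q).
Proof.
move=> h; rewrite /intertwines /exp_trunc mulr_suml mulr_sumr.
apply: eq_bigr => n _.
exact/intertwinesZ/intertwinesX.
Qed.

Lemma exp_pow_deriv_intertwines i j a k z :
  sphereS2 i -> sphereS2 j -> slit_plane z ->
  intertwines (rep_coef j i) (exp_pow_deriv j a k z) (exp_pow_deriv i a k z).
Proof.
move=> Si Sj sz.
have tP : intertwines (rep_coef j i) (slice_pow j a z) (slice_pow i a z).
  exact: rep_coef_slice.
apply: intertwinesM; first exact: intertwines_exp_trunc.
apply: intertwinesM => //; apply: intertwinesZ.
apply: intertwinesV; rewrite ?slice_pt_neq0//.
exact: rep_coef_slice.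
Qed.

(** The operator inherits the representation formula from f and its derivative,
    since the derivative of e_k (z^a) has the same components in all slices and
    is therefore intertwined by the coefficients. *)
Lemma dsigma_rep (a s : R) k i j f z : 0 < a -> (0 < k)%N ->
  (forall q, slit_qball q -> exp_trunc k.-1 (qpow q a) <> 0) ->
  sphereS2 i -> sphereS2 j -> slice_regular qball f -> slit_disc z ->
  dsigma a s k j f (slice_pt j z.1 z.2) =
    rep_coef j i * dsigma a s k i f (slice_pt i z.1 z.2) +
    rep_coef j (- i) * dsigma a s k (- i) f (slice_pt (- i) z.1 z.2).
Proof.
move=> a0 k0 ek Si Sj rf zD; have [z1 sz] := zD; have Sn := sphereN Si.
rewrite !dsigmaE// (representation_formula rf Si Sj z1).
have -> : slice_deriv f j z = rep_coef j i * slice_deriv f i z +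
    rep_coef j (- i) * slice_deriv f (- i) z.
  by move: z1; case: (z) => x y; exact: representation_formula_deriv.
have tV i' : sphereS2 i' -> (exp_pow_deriv j a k z)^-1 * rep_coef j i' =
    rep_coef j i' * (exp_pow_deriv i' a k z)^-1.
  move=> Si'; apply: intertwinesV; try exact: exp_pow_deriv_neq0.
  exact: exp_pow_deriv_intertwines.
rewrite [(exp_pow_deriv j a k z)^-1 * _]mulrDr !mulrA !tV// -!mulrA.
by rewrite !scalerDr !mulrDr -!scalerAr addrACA.
Qed.

(** The slices of i and - i are the same set, and conjugation exchanges their
    parametrizations. *)
Lemma dsigmaN (a s : R) k i f z : sphereS2 i ->
  dsigma a s k (- i) f (slice_pt (- i) z.1 z.2) =
  dsigma a s k i f (slice_pt i z.1 (- z.2)).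
Proof.
move=> Si; have -> : dsigma a s k (- i) f = dsigma a s k i f.
  apply/funext => w; rewrite /dsigma.
  suff -> : slit_slice (- i) = slit_slice i by [].
  rewrite /slit_slice; congr (_ `&` _); apply/seteqP.
  split=> q [x [y ->]]; exists x, (- y).
    by rewrite slice_ptN.
  by rewrite slice_ptN opprK.
by rewrite slice_ptN.
Qed.

Lemma dsigma_rep_le (a s : R) k i j f z : 0 < a -> (0 < k)%N ->
  (forall q, slit_qball q -> exp_trunc k.-1 (qpow q a) <> 0) ->
  sphereS2 i -> sphereS2 j -> slice_regular qball f -> slit_disc z ->
  `|dsigma a s k j f (slice_pt j z.1 z.2)| ^+ 2 <=
    2 * `|dsigma a s k i f (slice_pt i z.1 z.2)| ^+ 2 +
    2 * `|dsigma a s k i f (slice_pt i z.1 (- z.2))| ^+ 2.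
Proof.
move=> a0 k0 ek Si Sj rf zD; have Sn := sphereN Si.
rewrite (dsigma_rep s a0 k0 ek Si Sj rf zD) dsigmaN//.
set p := dsigma _ _ _ _ _ _; set q := dsigma _ _ _ _ _ _; clearbody p q.
have h : `|rep_coef j i * p + rep_coef j (- i) * q| <= `|p| + `|q|.
  apply: (le_trans (ler_normD _ _)); rewrite quat_normM [leLHS]addrC.
  rewrite quat_normM [leLHS]addrC.
  by apply: lerD; rewrite ler_piMl// rep_coef_norm.
apply: (@le_trans _ _ ((`|p| + `|q|) ^+ 2)).
  by rewrite ler_pXn2r ?nnegrE// addr_ge0.
move: `|p| `|q| => b c; rewrite -subr_ge0.
by have -> : 2 * b ^+ 2 + 2 * c ^+ 2 - (b + c) ^+ 2 = (b - c) ^+ 2;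
  [ring|exact: sqr_ge0].
Qed.

End fractional_derivative.

(** * Measurability *)

Section plane_measurability.
Variable R : realType.
Local Notation H := (quat R).

(** An open set is the countable union of the rational squares that it
    contains. *)
Lemma open_measurable_plane (O : set (R * R)) : open O -> measurable O.
Proof.
move=> oO.
pose B (a b r : rat) : set (R * R) :=
  `](ratr a - ratr r : R), (ratr a + ratr r : R)[ `*`
  `](ratr b - ratr r : R), (ratr b + ratr r : R)[.
pose F a b r : set (R * R) := if `[< B a b r `<=` O >] then B a b r else set0.
have -> : O = \bigcup_a \bigcup_b \bigcup_r F a b r.
  apply/seteqP; split=> [z Oz|z [a _ [b _ [r _]]]]; last first.
    by rewrite /F; case: asboolP => // BO; exact: BO.
  have /nbhs_normP [d /= d0 Hd] : nbhs z O by exact: open_nbhs_nbhs.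
  have [a] : exists a, ratr a \in `]z.1 - d / 4, z.1 + d / 4[.
    by apply: rat_in_itvoo; lra.
  have [b] : exists b, ratr b \in `]z.2 - d / 4, z.2 + d / 4[.
    by apply: rat_in_itvoo; lra.
  have [r] : exists r, ratr r \in `]d / 4, d / 2[ by apply: rat_in_itvoo; lra.
  rewrite !in_itv /= => rd bz az.
  exists a => //; exists b => //; exists r => //.
  rewrite /F; case: asboolP => [_|[]].
    by split; rewrite /= in_itv /=; lra.
  move=> w [] /=; rewrite !in_itv /= => w1 w2; apply: Hd.
  rewrite /ball_ /= prod_normE /= gt_max !ltr_norml; lra.
apply: bigcupT_measurable_rat => a; apply: bigcupT_measurable_rat => b.
apply: bigcupT_measurable_rat => r; rewrite /F; case: asboolP => // _.
by apply: measurableX; exact: measurable_itv.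
Qed.

Lemma measurable_fun_open (D : set (R * R)) (g : R * R -> R) : open D ->
  (forall z, D z -> {for z, continuous g}) -> measurable_fun D g.
Proof.
move=> oD cg mD; apply: (measurability _ (RGenOInfty.measurableE R)) => //.
move=> /= _ [_ [a ->]] <-; apply: open_measurable_plane.
rewrite openE => z [Dz gz]; rewrite /interior /=.
apply: filterI; first by apply: open_nbhs_nbhs.
apply: (cg _ Dz); apply: open_nbhs_nbhs; split=> //.
Qed.

(** A partial derivative is the limit of the difference quotients of step
    1 / (n + 1).  The function is extended by 0 outside D, where it need not be
    measurable; this does not affect the limit since D is open. *)
Lemma measurable_partial (D : set (R * R)) (g dg : R * R -> R) : open D ->
  (forall z, D z -> exists B, is_diff z g (fun h => h.1 * dg z + h.2 * B)) ->
  measurable_fun D dg.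
Proof.
move=> oD Hg.
have mg : measurable_fun D g.
  apply: measurable_fun_open => // z /Hg [B dB].
  exact: differentiable_continuous.
have mD : measurable D by exact: open_measurable_plane.
have mgD : measurable_fun setT (g \_ D).
  exact: (measurable_restrictT g mD).1 mg.
pose h (n : nat) (z : R * R) :=
  n.+1%:R * ((g \_ D) (z.1 + n.+1%:R^-1, z.2) - g z).
apply: (@measurable_fun_cvg _ _ _ _ h).
  move=> n; apply: measurable_funM; first exact: measurable_cst.
  apply: measurable_funB => //.
  apply: (@measurable_funS _ _ _ _ setT) => //.
  apply: (measurableT_comp mgD).
  apply/measurable_fun_pairP; split=> /=.
    exact: measurable_funD measurable_fst (measurable_cst _).
  exact: measurable_snd.
move=> z Dz; apply/cvgrPdist_le => e e0.
have [B dB] := Hg z Dz.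
have [d d0 Hd] := is_diff_near dB e0.
have /nbhs_normP [r /= r0 Hr] : nbhs z D by exact: open_nbhs_nbhs.
have m0 : 0 < Num.min d r by rewrite lt_min d0.
near=> n.
have nm : n.+1%:R^-1 < Num.min d r.
  near: n; exact: near_infty_natSinv_lt (PosNum m0).
move: nm; rewrite lt_min => /andP[nd nr].
pose q := (z.1 + n.+1%:R^-1, z.2).
have n0 : 0 < n.+1%:R^-1 :> R by rewrite invr_gt0.
have qz : q - z = (n.+1%:R^-1, 0).
  rewrite /q; case: (z) => x y /=; congr pair; rewrite /= ?subrr//.
  by rewrite addrAC subrr add0r.
have nqz : `|q - z| = n.+1%:R^-1.
  by rewrite qz prod_normE /= normr0 gtr0_norm// max_l// ltW.
have Dq : D q by apply: Hr; rewrite /ball_ /= distrC nqz.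
have := Hd q; rewrite nqz => /(_ nd).
rewrite /h -/q patchE mem_set// qz /= mul0r addr0 => H1.
rewrite distrC.
have -> : n.+1%:R * (g q - g z) - dg z =
    n.+1%:R * (g q - g z - n.+1%:R^-1 * dg z).
  by rewrite [RHS]mulrBr mulrA mulfV ?mul1r// gt_eqF.
rewrite normrM gtr0_norm// mulrC -ler_pdivlMr//.
Unshelve. all: by end_near. Qed.

End plane_measurability.

Section quat_measurability.
Variable R : realType.
Local Notation H := (quat R).
Implicit Types (D : set (R * R)) (F G : R * R -> H) (z : R * R).

(** Measurability of the four components, each of which is Re (F c) for a
    suitable unit c.  Quantifying over all c treats them uniformly, and Re (F c)
    is also the form in which derivatives of F are available. *)
Definition quat_measurable D F := forall c : H,
  measurable_fun D (fun z => q0 (F z * c)).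

Lemma quat_measurable_coord D F : quat_measurable D F ->
  [/\ measurable_fun D (fun z => q0 (F z)), measurable_fun D (fun z => q1 (F z)),
      measurable_fun D (fun z => q2 (F z)) & measurable_fun D (fun z => q3 (F z))].
Proof.
move=> mF; split.
- by have := mF 1; congr measurable_fun; apply/funext => z; rewrite mulr1.
- have := mF (Quat 0 (- 1) 0 0).
  by congr measurable_fun; apply/funext => z /=; ring.
- have := mF (Quat 0 0 (- 1) 0).
  by congr measurable_fun; apply/funext => z /=; ring.
- have := mF (Quat 0 0 0 (- 1)).
  by congr measurable_fun; apply/funext => z /=; ring.
Qed.

Lemma coord_quat_measurable D F :
  measurable_fun D (fun z => q0 (F z)) -> measurable_fun D (fun z => q1 (F z)) ->
  measurable_fun D (fun z => q2 (F z)) -> measurable_fun D (fun z => q3 (F z)) ->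
  quat_measurable D F.
Proof.
by move=> m0 m1 m2 m3 c; rewrite /=;
  do 3 (apply: measurable_funB; last by apply: measurable_funM;
    [assumption|exact: measurable_cst]); apply: measurable_funM;
    [assumption|exact: measurable_cst].
Qed.

Lemma quat_measurableD D F G : quat_measurable D F -> quat_measurable D G ->
  quat_measurable D (fun z => F z + G z).
Proof.
move=> mF mG c; have := measurable_funD (mF c) (mG c).
by congr measurable_fun; apply/funext => z; rewrite mulrDl.
Qed.

Lemma quat_measurableZ D F (g : R * R -> R) : measurable_fun D g ->
  quat_measurable D F -> quat_measurable D (fun z => g z *: F z).
Proof.
move=> mg mF c; have := measurable_funM mg (mF c).
by congr measurable_fun; apply/funext => z; rewrite -scalerAl.
Qed.

Lemma quat_measurableM D F G : quat_measurable D F -> quat_measurable D G ->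
  quat_measurable D (fun z => F z * G z).
Proof.
move=> /quat_measurable_coord[f0 f1 f2 f3] /quat_measurable_coord[g0 g1 g2 g3].
by apply: coord_quat_measurable => /=; repeat first
  [apply: measurable_funB|apply: measurable_funD|apply: measurable_funM|assumption].
Qed.

Lemma measurable_sqnorm D F : quat_measurable D F ->
  measurable_fun D (fun z => quat_sqnorm (F z)).
Proof.
move=> /quat_measurable_coord[f0 f1 f2 f3]; rewrite /quat_sqnorm.
by repeat first [apply: measurable_funD|apply: measurable_funX|assumption].
Qed.

Lemma quat_measurable_cont D F : open D ->
  (forall z, D z -> {for z, continuous F}) -> quat_measurable D F.
Proof.
move=> oD cF c; apply: measurable_fun_open => // z Dz.
apply: (@continuous_comp _ _ _ F (fun x => q0 (x * c))); first exact: cF.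
apply: differentiable_continuous.
have L : is_diff (F z) (fun x => q0 (x * c)) (fun x => q0 (x * c)).
  apply: (@is_diff_lin_bounded _ _ _ _ `|c|).
    by move=> r x y; rewrite mulrDl -scalerAl.
  by move=> x; rewrite mulrC -quat_normM; exact: norm_q0_le.
exact: ex_diff.
Qed.

Lemma quat_measurable_partial D (i : H) F (dF : R * R -> H) : open D ->
  (forall z, D z -> slice_diff i F z (dF z)) -> quat_measurable D dF.
Proof.
move=> oD HF c; apply: (@measurable_partial R D (fun z => q0 (F z * c))) => //.
move=> z Dz; exists (q0 (i * dF z * c)).
apply: (is_diff_eq (is_diff_q0 (is_diff_rmul c (HF z Dz)))).
apply/funext => h; rewrite /slice_pt mulrDl -!scalerAl mul1r mulrDl -!scalerAl.
by [].
Qed.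

Lemma open_slit_disc : open (@slit_disc R).
Proof.
have -> : @slit_disc R = [set z | z.1 ^+ 2 + z.2 ^+ 2 < 1] `&`
    ((fun z : R * R => z.1) @^-1` [set x | 0 < x] `|`
     (fun z : R * R => z.2) @^-1` [set y | y != 0]).
  apply/seteqP; split=> z [z1 sz]; split=> //=.
    by have [e|e] := eqVneq z.2 0; [left; exact: sz|right].
  by move=> e; case: sz => //=; rewrite e eqxx.
apply: openI; first exact: open_disc.
apply: openU; apply: open_comp.
- by move=> z _; exact: cvg_fst.
- exact: open_gt.
- by move=> z _; exact: cvg_snd.
- exact: open_neq.
Qed.

Lemma slice_diff_continuous (i : H) F z E : slice_diff i F z E ->
  {for z, continuous F}.
Proof. by move=> [dF _]; exact: differentiable_continuous. Qed.

Lemma exp_pow_deriv_continuous (i : H) a k z : sphereS2 i -> slit_disc z ->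
  {for z, continuous (exp_pow_deriv i a k)}.
Proof.
move=> Si [_ sz].
have [A [B [dAB _]]] := cr_pow a sz.
have hP : slice_hol i (slice_pow i a) z (slice_pt i A B).
  by exists (pow_re a), (pow_im a), A, B.
have cP : {for z, continuous (slice_pow i a)}.
  exact: slice_diff_continuous (slice_hol_diff Si hP).
apply: quat_cvgM.
  case: k.-1 => [|m].
    rewrite exp_trunc0.
    have -> : (fun t => exp_trunc 0 (slice_pow i a t)) = cst 1.
      by apply/funext => t; rewrite exp_trunc0.
    exact: cvg_cst.
  have hE := slice_hol_exp_trunc Si hP (ltn0Sn m).
  exact: slice_diff_continuous (slice_hol_diff Si hE).
apply: quat_cvgM => //; apply: cvgZ; first exact: cvg_cst.
apply: quat_cvgV; first exact: slice_pt_neq0.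
have [dz _] := is_diff_slice_pt i z.
exact: (differentiable_continuous dz).
Qed.

(** By dsigmaE the operator is an algebraic expression in f, its derivative, and
    the derivative of e_k (z^a).  The first and the last are continuous; the
    derivative of f is only known to be measurable. *)
Lemma measurable_dsigma (a s : R) k (i : H) f : 0 < a -> (0 < k)%N ->
  (forall q, slit_qball q -> exp_trunc k.-1 (qpow q a) <> 0) ->
  sphereS2 i -> slice_regular qball f ->
  measurable_fun (@slit_disc R)
    (fun z => `|dsigma a s k i f (slice_pt i z.1 z.2)| ^+ 2).
Proof.
move=> a0 k0 ek Si rf.
pose G z := (1 - s) *: f (slice_pt i z.1 z.2) +
    s *: ((exp_pow_deriv i a k z)^-1 * slice_deriv f i z).
apply: (@eq_measurable_fun _ _ _ _ _ (fun z => quat_sqnorm (G z))).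
  by move=> z; rewrite inE => zD; rewrite (dsigmaE s a0)// -quat_norm_sq.
have oD := open_slit_disc.
have df z : slit_disc z ->
    slice_diff i (fun z => f (slice_pt i z.1 z.2)) z (slice_deriv f i z).
  move=> [z1 _]; have := slice_regular_diff rf Si ((qball_slice z.1 z.2 Si).2 z1).
  by case: z {z1}.
apply: measurable_sqnorm; apply: quat_measurableD; apply: quat_measurableZ.
- exact: measurable_cst.
- apply: quat_measurable_cont => // z /df; exact: slice_diff_continuous.
- exact: measurable_cst.
- apply: quat_measurableM; last exact: quat_measurable_partial df.
  apply: quat_measurable_cont => // z zD.
  apply: quat_cvgV; first exact: exp_pow_deriv_neq0.
  exact: exp_pow_deriv_continuous.
Qed.

End quat_measurability.

(** * Invariance of the area under conjugation *)

Section reflection.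
Variable R : realType.
Local Notation mu := (@lebesgue_measure R).
Local Notation plane := (measurableTypeR R * measurableTypeR R)%type.

Definition conj_pt (z : R * R) : R * R := (z.1, - z.2).

Lemma measurable_conj_pt : measurable_fun setT conj_pt.
Proof.
apply/measurable_fun_pairP; split; first exact: measurable_fst.
exact: measurableT_comp (@oppr_measurable R setT) measurable_snd.
Qed.

(** The image of the area by conjugation agrees with the area on products of
    measurable sets, hence everywhere. *)
Lemma integral_conj (D : set plane)
    (g : R * R -> \bar R) :
  measurable D -> (forall z, D (conj_pt z) <-> D z) -> measurable_fun D g ->
  (forall z, D z -> (0 <= g z)%E) ->
  (\int[mu \x mu]_(z in D) g (conj_pt z) = \int[mu \x mu]_(z in D) g z)%E.
Proof.
move=> mD DD mg g0.
have mphi : measurable_fun setT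
  (conj_pt : plane -> plane).
  exact: measurable_conj_pt.
pose m' : {measure set plane -> \bar R} :=
  pushforward (mu \x mu)%E (conj_pt : plane -> plane).
have E A : measurable A -> (mu \x mu)%E A = m' mphi A.
  apply: product_measure_unique => X Y mX mY.
  transitivity ((mu \x mu)%E (X `*` (-%R @^-1` Y))); first by [].
  rewrite product_measure1E//; last first.
    rewrite -[X in measurable X]setTI; exact: oppr_measurable.
  congr (_ * _)%E; exact: (lebesgue_measureN mY).
have DE : conj_pt @^-1` D = D by apply/seteqP; split=> z /DD.
have g0' : {in D, forall z, (0 <= g z)%E} by move=> z; rewrite inE; exact: g0.
have P := ge0_integral_pushforward mphi (mu \x mu)%E mD mg g0'.
rewrite DE in P; rewrite -[LHS]P.
apply: (eq_measure_integral (mu \x mu)%E) => A mA _; exact/esym/E.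
Qed.

Lemma le_integral_conj (D : set plane)
    (g h : R * R -> \bar R) :
  measurable D -> (forall z, D (conj_pt z) <-> D z) ->
  measurable_fun D g -> measurable_fun D h ->
  (forall z, (0 <= g z)%E) -> (forall z, (0 <= h z)%E) ->
  (forall z, D z -> (g z <= 2%:E * h z + 2%:E * h (conj_pt z))%E) ->
  (\int[mu \x mu]_(z in D) g z <= 4%:E * \int[mu \x mu]_(z in D) h z)%E.
Proof.
move=> mD DC mg mh g0 h0 gh.
have mhc : measurable_fun D (fun z => h (conj_pt z)).
  apply: (measurable_comp (F := D)) => //.
    by move=> _ [z zD <-]; exact/DC.
  exact: measurable_funS measurable_conj_pt.
have m2 (u : R * R -> \bar R) : measurable_fun D u ->
    measurable_fun D (fun z => 2%:E * u z)%E by exact: measurable_funeM.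
have p2 (u : R * R -> \bar R) : (forall z, 0 <= u z)%E ->
    forall z, D z -> (0 <= 2%:E * u z)%E by move=> u0 z _; rewrite mule_ge0.
apply: (@le_trans _ _
    (\int[mu \x mu]_(z in D) (2%:E * h z + 2%:E * h (conj_pt z)))%E).
  apply: ge0_le_integral => //.
  by apply: emeasurable_funD; exact: m2.
have hc0 z : (0 <= h (conj_pt z))%E by [].
rewrite ge0_integralD//; [|exact: p2|exact: m2|exact: p2|exact: m2].
rewrite !ge0_integralZl//.
have IC := integral_conj mD DC mh (fun z _ => h0 z).
rewrite [X in (_ + _ * X)%E]IC -ge0_muleDl// -EFinD.
by have -> : 2 + 2 = 4 :> R by ring.
Qed.

End reflection.

(** * The comparison of the norms *)

Lemma lee_add_mul8 (R : realType) (c : R) (x y : \bar R) :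
  0 <= c -> (0 <= y)%E -> (x <= 4%:E * y)%E ->
  (c%:E + x <= 8%:E * (c%:E + y))%E.
Proof.
move=> c0 y0 xy; rewrite ge0_muleDr//; apply: leeD.
  by rewrite -EFinM lee_fin ler_peMl// ler1n.
by apply: (le_trans xy); apply: lee_wpmul2r => //; rewrite lee_fin ler_nat.
Qed.

Unset Implicit Arguments.

Theorem proposition5p14 (R : realType) (alpha sigma : R) (k : nat)
    (i j : quat R) (f : quat R -> quat R) :
  0 < alpha <= 1 ->
  0 < sigma < 1 ->
  (1 <= k)%N ->
  (forall q, slit_qball q -> exp_trunc k.-1 (qpow q alpha) <> 0) ->
  sphereS2 i ->
  sphereS2 j ->
  slice_regular qball f ->
  dirichlet_space alpha sigma k i f ->
  (dirichlet_sqnorm alpha sigma k j f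
     <= 8%:E * dirichlet_sqnorm alpha sigma k i f)%E.
Proof.
move=> /andP[a0 _] _ k0 ek Si Sj rf _.
have mD := open_measurable_plane (@open_slit_disc R).
pose G (l : quat R) (z : R * R) : \bar R :=
  (`|dsigma alpha sigma k l f (slice_pt l z.1 z.2)| ^+ 2)%:E.
have mG l : sphereS2 l -> measurable_fun (@slit_disc R) (G l).
  by move=> Sl; apply/measurable_EFinP; exact: measurable_dsigma.
have G0 l z : (0 <= G l z)%E by rewrite lee_fin sqr_ge0.
have DC (z : R * R) : slit_disc (conj_pt z) <-> slit_disc z.
  rewrite /slit_disc /slit_plane /= sqrrN.
  by split=> -[z1 sz]; split=> // e; apply: sz; [rewrite e oppr0|
    apply/eqP; rewrite -oppr_eq0 e].
have DE l : sphereS2 l ->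
    [set p : R * R | slit_slice l (slice_pt l p.1 p.2)] = @slit_disc R.
  by move=> Sl; apply/seteqP; split=> z /= /(slit_slice_pt z Sl).
have GG z : slit_disc z -> (G j z <= 2%:E * G i z + 2%:E * G i (conj_pt z))%E.
  move=> zD; rewrite /G -!EFinM -EFinD lee_fin; exact: dsigma_rep_le.
have main := le_integral_conj mD DC (mG j Sj) (mG i Si) (G0 j) (G0 i) GG.
rewrite /dirichlet_sqnorm /area_measure !DE//.
have I0 : (0 <= \int[@lebesgue_measure R \x @lebesgue_measure R]_(z in
    @slit_disc R) G i z)%E by apply: integral_ge0 => z _; exact: G0.
have c0 : 0 <= alpha * `|f ((2^-1 : R)%:A)| ^+ 2.
  by rewrite mulr_ge0 ?sqr_ge0// ltW.
exact: (lee_add_mul8 c0 I0 main).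
Qed.
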